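(* Let $\Omega=B_R$ be a ball of radius $R$ in $\mathbb{R}^N$, $N\ge2$, and let $(u,v)$ be a non-negative solution of $$u_t+\delta_1(t)\Delta^2u=k_1(t)f_1(v),\qquad v_t+\delta_2(t)\Delta^2v=k_2(t)f_2(u),\qquad x\in\Omega,\ t\in(0,t^* ),$$ $$u=v=0,\quad \frac{\partial u}{\partial n}=\frac{\partial v}{\partial n}=0,\qquad x\in\partial\Omega,\ t\in(0,t^* ),\qquad u(x,0)=u_0(x),\ v(x,0)=v_0(x),\quad x\in\Omega.$$ Let $$\Psi(t)=\int_\Omega u\,\phi_1\,dx+\int_\Omega v\,\phi_1\,dx,\qquad \Psi_0=\Psi(0)=\int_\Omega u_0\phi_1\,dx+\int_\Omega v_0\phi_1\,dx,$$ where $\phi_1$ is the first eigenfunction, with first eigenvalue $\Lambda_1$, of the Dirichlet biharmonic problem on $\Omega$. Assume $$f_1(s)\ge s^p,\qquad f_2(s)\ge s^p,\qquad s>0,\qquad\text{with } p>1,$$ and that, with the positive constants $\delta,\bar c$ defined in the context, the initial data satisfy $$\Psi_0>\Big(\frac{\delta\Lambda_1}{\bar c}\Big)^{\frac1{p-1}}.$$ Then $\Psi(t)$ must blow up at a time $t^*\le\overline T$ (that is, $\lim_{t\to t^*}\Psi(t)=\infty$), with $$\overline T:=-\frac{1}{(p-1)\delta\Lambda_1}\log\Big\{1-\frac{\delta\Lambda_1}{\bar c\,\Psi_0^{p-1}}\Big\}.$$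
   Context: Standing assumptions: the coefficients $\delta_i,k_i$ ($i=1,2$) are positive bounded functions of $t$; $f_1,f_2$ are non-negative functions; $u_0,v_0\in W^{2,2}_0(\Omega)$ are non-negative; $\partial/\partial n$ is the outward normal derivative on $\partial\Omega$; $t^*$ denotes the blow-up time of the solution. Solution: for $T'\in(0,t^* )$, $u$ and $v$ belong to $C(0,T';W_0^{2,2}(\Omega))\cap L^2(0,T';W^{4,2}(\Omega))\cap W^{1,2}(0,T';L^2(\Omega))$, continuity in time including $t=0$, and the source terms $f_1(v),f_2(u)$ belong to $L^2(0,T';L^2(\Omega))$. Eigenvalue problem: $\Lambda_1$ is the first eigenvalue and $\phi_1$ the associated first eigenfunction of $\Delta^2\phi=\Lambda\phi$ in $\Omega$, $\phi=\partial\phi/\partial n=0$ on $\partial\Omega$, normalized by $\|\phi_1\|_{L^2(\Omega)}^2=1$. Since $\Omega$ is a ball, $\phi_1$ is taken non-negative (positivity preserving property), so $\Psi\ge0$. Constants: with $|\Omega|$ the Lebesgue measure of $\Omega$ and suprema and infima over $t\in(0,t^* )$, $$\delta=\max\{\sup_t\delta_1(t),\ \sup_t\delta_2(t)\},\qquad \bar c=2^{1-p}\,|\Omega|^{-\frac{p-1}{2}}\min\{\inf_tk_1(t),\ \inf_tk_2(t)\},$$ and it is assumed that $\bar c>0$.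
   Formalization: The sense in which t* is the blow-up time is left open in the text; the bound t* ≤ T̄ is proved for every solution on (0,t* ), while lim Ψ(t)=∞ as t→t* is proved when t* is the blow-up time in terms of Ψ, i.e. when Ψ is unbounded as t→t*. *)

(* Defs.v *)
From HB Require Import structures.
From mathcomp Require Import all_boot all_order all_algebra.
From mathcomp Require Import all_classical all_reals all_analysis.

Set Implicit Arguments.
Unset Strict Implicit.
Unset Printing Implicit Defensive.
Import Order.TTheory GRing.Theory Num.Theory.
Import numFieldNormedType.Exports.

Local Open Scope classical_set_scope.
Local Open Scope ring_scope.

Definition matrix_display : measure_display -> measure_display.
Proof. exact. Qed.

Section measurable_matrix.
Context {d} {T : sigmaRingType d} (m n : nat).

Definition matrix_cylinders : set (set 'M[T]_(m, n)) :=
  \bigcup_(ij in [set: 'I_m * 'I_n])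
    preimage_set_system setT (fun A : 'M[T]_(m, n) => A ij.1 ij.2) measurable.

Let matrix_set0 : <<s matrix_cylinders >> set0.
Proof. exact: sigma_algebra0. Qed.

Let matrix_setC A : <<s matrix_cylinders >> A -> <<s matrix_cylinders >> (~` A).
Proof. exact: sigma_algebraC. Qed.

Let matrix_bigcup (F : (set 'M[T]_(m, n))^nat) :
  (forall i, <<s matrix_cylinders >> (F i)) ->
  <<s matrix_cylinders >> (\bigcup_i (F i)).
Proof. exact: sigma_algebra_bigcup. Qed.

HB.instance Definition _ := @isMeasurable.Build (matrix_display d)
  'M[T]_(m, n) <<s matrix_cylinders >> matrix_set0 matrix_setC matrix_bigcup.

Lemma measurable_matrix_coord i j :
  measurable_fun [set: 'M[T]_(m, n)] (fun A : 'M[T]_(m, n) => A i j).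
Proof.
move=> _ Y mY; rewrite setTI; apply: sub_sigma_algebra.
by exists (i, j) => //; exists Y => //; rewrite setTI.
Qed.

Lemma measurable_fun_matrix d' (T' : measurableType d')
    (f : T' -> 'M[T]_(m, n)) :
  (forall i j, measurable_fun setT (fun x => f x i j)) -> measurable_fun setT f.
Proof.
move=> mf _ Y mY; rewrite setTI.
have : <<s matrix_cylinders >> `<=` [set A | measurable (f @^-1` A)].
  apply: smallest_sub.
    split => /=.
    - by rewrite preimage_set0.
    - by move=> A mA; rewrite setTD preimage_setC; exact: measurableC.
    - by move=> F mF; rewrite preimage_bigcup; exact: bigcup_measurable.
  move=> _ [[i j] _ [B mB <-]] /=.
  rewrite setTI -comp_preimage -[X in measurable X]setTI.
  exact: mf.
exact.
Qed.

End measurable_matrix.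

(* Lebesgue measure on R^n, as an iterated product (see [lebesgue_rV_box]). *)
Section lebesgue_rV.
Context {R : realType}.

Definition rV_cons n (p : measurableTypeR R * 'rV[R]_n) : 'rV[R]_n.+1 :=
  \row_j (if unlift ord0 j is Some k then p.2 0 k else p.1).

Lemma measurable_rV_cons n : measurable_fun setT (@rV_cons n).
Proof.
apply: measurable_fun_matrix => i j; case: (unliftP ord0 j) => [k ->|->].
- rewrite (_ : (fun _ => _) = (fun A : 'rV[R]_n => A 0 k) \o snd).
    exact: (measurableT_comp (measurable_matrix_coord 0 k) measurable_snd).
  by apply/funext => x; rewrite mxE liftK.
- rewrite (_ : (fun _ => _) = fst); first exact: measurable_fst.
  by apply/funext => x; rewrite mxE unlift_none.
Qed.

Definition rV_uncons n (x : 'rV[R]_n.+1) : measurableTypeR R * 'rV[R]_n :=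
  (x 0 ord0, \row_k x 0 (lift ord0 k)).

Lemma rV_consK n : cancel (@rV_cons n) (@rV_uncons n).
Proof.
case=> a x; congr pair => /=; first by rewrite mxE unlift_none.
by apply/rowP => j; rewrite !mxE liftK.
Qed.

Lemma measurable_rV_uncons n : measurable_fun setT (@rV_uncons n).
Proof.
apply/measurable_fun_pairP; split; first exact: measurable_matrix_coord.
apply: measurable_fun_matrix => i j.
rewrite (_ : (fun _ => _) = fun A : 'rV[R]_n.+1 => A 0 (lift ord0 j)).
  exact: measurable_matrix_coord.
by apply/funext => x; rewrite /rV_uncons /= mxE.
Qed.

Section step.
Local Open Scope ereal_scope.
Variables (n : nat) (m : {sigma_finite_measure set 'rV[R]_n -> \bar R}).

Definition lebesgue_rV_step : set 'rV[R]_n.+1 -> \bar R :=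
  pushforward (lebesgue_measure \x m) (@rV_cons n).

Let step0 : lebesgue_rV_step set0 = 0.
Proof. by rewrite /lebesgue_rV_step /pushforward preimage_set0 measure0. Qed.

Let step_ge0 A : 0 <= lebesgue_rV_step A.
Proof. by rewrite /lebesgue_rV_step /pushforward; exact: measure_ge0. Qed.

Let step_sigma_additive : semi_sigma_additive lebesgue_rV_step.
Proof.
have mc B : measurable B -> measurable (@rV_cons n @^-1` B).
  by move=> mB; rewrite -[X in measurable X]setTI; exact: measurable_rV_cons.
move=> F mF tF mUF; rewrite /lebesgue_rV_step /pushforward preimage_bigcup.
apply: measure_semi_sigma_additive.
- by move=> k; exact: mc.
- apply/trivIsetP => /= i j _ _ ij; rewrite -preimage_setI.
  by move/trivIsetP : tF => /(_ _ _ _ _ ij) ->//; rewrite preimage_set0.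
- by rewrite -preimage_bigcup; exact: mc.
Qed.

HB.instance Definition _ := isMeasure.Build _ _ _ lebesgue_rV_step
  step0 step_ge0 step_sigma_additive.

Let step_sigma_finite : sigma_finite setT lebesgue_rV_step.
Proof.
have /sigma_finiteP[F [TF ndF Foo]] :=
  sigma_finiteT (@lebesgue_measure R : {sigma_finite_measure set _ -> \bar R}).
have /sigma_finiteP[G [TG ndG Goo]] := sigma_finiteT m.
exists (fun k => @rV_uncons n @^-1` (F k `*` G k)) => [|k].
  rewrite -preimage_bigcup (_ : \bigcup_k _ = setT) ?preimage_setT//.
  apply/seteqP; split => // -[x y] _.
  have [i _ Fx] : (\bigcup_k F k) x by rewrite -TF.
  have [j _ Gy] : (\bigcup_k G k) y by rewrite -TG.
  exists (maxn i j) => //; split => /=.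
  - by move: x Fx; exact/subsetPset/ndF/leq_maxl.
  - by move: y Gy; exact/subsetPset/ndG/leq_maxr.
have [mF Fk] := Foo k; have [mG Gk] := Goo k; split.
  rewrite -[X in measurable X]setTI; apply: measurable_rV_uncons => //.
  exact: measurableX.
rewrite /lebesgue_rV_step /pushforward -comp_preimage.
rewrite (_ : _ \o _ = id); last by apply/funext => p; exact: rV_consK.
by rewrite product_measure1E// lte_mul_pinfty// ge0_fin_numE.
Qed.

HB.instance Definition _ := Measure_isSigmaFinite.Build _ _ _ lebesgue_rV_step
  step_sigma_finite.

End step.

Fixpoint lebesgue_rV (n : nat) : {sigma_finite_measure set 'rV[R]_n -> \bar R} :=
  match n with
  | 0 => \d_(0 : 'rV[R]_0)
  | m.+1 => lebesgue_rV_step (lebesgue_rV m)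
  end.

Lemma lebesgue_rV_box n (A : 'I_n -> set R) :
  (forall i, measurable (A i)) ->
  lebesgue_rV n [set x | forall i, A i (x 0 i)] =
  (\prod_(i < n) lebesgue_measure (A i))%E.
Proof.
elim: n A => [|n IH] A mA.
  by rewrite big_ord0 /= diracE mem_set// => -[].
rewrite big_ord_recl -IH //= /lebesgue_rV_step /pushforward.
have mB : measurable
    [set x : 'rV[R]_n | forall i, A (lift ord0 i) (x 0 i)].
  rewrite (_ : mkset _ = \bigcap_(i in [set: 'I_n])
      ((fun x : 'rV[R]_n => x 0 i) @^-1` A (lift ord0 i))); last first.
    by apply/seteqP; split => x h i; [move=> _; exact: h|exact: h].
  apply: fin_bigcap_measurable => // i _.
  rewrite -[X in measurable X]setTI; exact: measurable_matrix_coord.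
rewrite -product_measure1E; [|exact: mA|exact: mB].
congr (product_measure1 _ _ _); apply/seteqP; split => [[a x] /= h|[a x] /= [Aa Ax] i].
- split => [|i]; first by have := h ord0; rewrite mxE unlift_none.
  by have := h (lift ord0 i); rewrite mxE liftK.
- by rewrite mxE; case: unliftP => [k ->|->].
Qed.

End lebesgue_rV.

Section smooth.
Context {R : realType} {V : normedModType R}.
Implicit Types (f : V -> R) (A : set V).

Definition iter_derive (s : seq V) f : V -> R :=
  foldr (fun v g x => 'D_v g x) f s.

Definition smooth f := forall (s : seq V) (x : V), differentiable (iter_derive s f) x.

Definition test_function A f :=
  [/\ smooth f, compact (closure [set x | f x != 0]) &
      closure [set x | f x != 0] `<=` A].

End smooth.

Definition square_integrable {R : realType} d (T : measurableType d)
    (mu : {measure set T -> \bar R}) (D : set T) (f : T -> R) :=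
  measurable_fun D f /\ mu.-integrable D (fun x => (f x ^+ 2)%:E).

Section sobolev.
Context {R : realType} {N : nat}.
Implicit Types (Omega : set 'rV[R]_N) (f g phi psi : 'rV[R]_N -> R).
Implicit Types (k : nat) (s : seq 'I_N) (D : seq 'I_N -> 'rV[R]_N -> R).

Definition ball_rV (c : 'rV[R]_N) (r : R) : set 'rV[R]_N :=
  [set x | \sum_(i < N) (x 0 i - c 0 i) ^+ 2 < r ^+ 2].

(* Partial derivatives are indexed by sequences of directions, so that
   [[:: i; j]] and [[:: j; i]] both occur among those of order 2. *)
Definition partials s f : 'rV[R]_N -> R :=
  iter_derive [seq delta_mx 0 i | i <- s] f.

Definition weak_derivative Omega s f g :=
  forall psi, test_function Omega psi ->
    \int[lebesgue_rV N]_(x in Omega) (f x * partials s psi x) =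
    (-1) ^+ size s * \int[lebesgue_rV N]_(x in Omega) (g x * psi x).

(* [f] belongs to W^{k,2}(Omega) iff it has a jet [D], [D s] being a
   square-integrable representative of the weak derivative of [f] along [s]. *)
Definition sobolev_jet k Omega f D :=
  D [::] = f /\
  forall s, (size s <= k)%N ->
    square_integrable (lebesgue_rV N) Omega (D s) /\
    weak_derivative Omega s f (D s).

(* The square of the W^{k,2}(Omega) norm. *)
Definition jet_sqnorm k Omega D : \bar R :=
  (\sum_(j < k.+1) \sum_(s : j.-tuple 'I_N)
     \int[lebesgue_rV N]_(x in Omega) ((D s x) ^+ 2)%:E)%E.

(* W_0^{k,2}(Omega), the closure of the test functions in W^{k,2}(Omega); for
   k = 2 it carries the conditions f = df/dn = 0 on the boundary of Omega. *)
Definition sobolev0 k Omega f :=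
  exists2 D, sobolev_jet k Omega f D &
  exists2 psi : nat -> 'rV[R]_N -> R,
    forall n, test_function Omega (psi n) &
    jet_sqnorm k Omega (fun s x => D s x - partials s (psi n) x)
      @[n --> \oo] --> 0%E.

Definition bilaplacian D (x : 'rV[R]_N) : R :=
  \sum_(i < N) \sum_(j < N) D [:: i; i; j; j] x.

Definition eigenpair Omega (Lambda : R) phi :=
  [/\ sobolev0 2 Omega phi,
      \int[lebesgue_rV N]_(x in Omega) (phi x ^+ 2) != 0 &
      forall psi, test_function Omega psi ->
        \int[lebesgue_rV N]_(x in Omega)
          (phi x * bilaplacian (partials ^~ psi) x) =
        Lambda * \int[lebesgue_rV N]_(x in Omega) (phi x * psi x)].

Definition first_eigenpair Omega (Lambda1 : R) phi1 :=
  [/\ eigenpair Omega Lambda1 phi1,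
      forall Lambda phi, eigenpair Omega Lambda phi -> Lambda1 <= Lambda &
      \int[lebesgue_rV N]_(x in Omega) (phi1 x ^+ 2) = 1].

Definition ae_nonneg Omega f :=
  {ae lebesgue_rV N, forall x, Omega x -> 0 <= f x}.

End sobolev.

Section evolution.
Context {R : realType} {N : nat}.
Implicit Types (Omega : set 'rV[R]_N) (T : R) (u h ut : R -> 'rV[R]_N -> R).
Implicit Types (k : nat) (D : R -> seq 'I_N -> 'rV[R]_N -> R).

Definition lebesgue_spacetime :
    {measure set (measurableTypeR R * 'rV[R]_N)%type -> \bar R} :=
  (lebesgue_measure \x lebesgue_rV N)%E.

Definition cylinder T Omega : set (measurableTypeR R * 'rV[R]_N)%type :=
  `]0, T[%classic `*` Omega.

(* L^2(0, T; L^2(Omega)), identified with L^2 of the space-time cylinder. *)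
Definition L2_L2 T Omega u :=
  square_integrable lebesgue_spacetime (cylinder T Omega) (fun p => u p.1 p.2).

Definition C_sobolev0 k T Omega u :=
  {in `[0, T], forall t, sobolev0 k Omega (u t)} /\
  exists2 D,
    {in `[0, T], forall t, sobolev_jet k Omega (u t) (D t)} &
    {in `[0, T], forall t0,
      jet_sqnorm k Omega (fun s x => D t s x - D t0 s x)
        @[t --> within `[0, T]%classic (nbhs t0)] --> 0%E}.

(* [u] belongs to L^2(0, T; W^{k,2}(Omega)), with jets [D t]. *)
Definition L2_sobolev k T Omega u D :=
  (forall s, (size s <= k)%N -> L2_L2 T Omega (fun t => D t s)) /\
  {ae lebesgue_measure,
    forall t : R, t \in `]0, T[ -> sobolev_jet k Omega (u t) (D t)}.

(* [u] belongs to W^{1,2}(0, T; L^2(Omega)), with weak time derivative [ut]. *)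
Definition W12_L2 T Omega u ut :=
  [/\ L2_L2 T Omega u, L2_L2 T Omega ut &
      forall theta : R -> R, test_function `]0, T[%classic theta ->
        {ae lebesgue_rV N, forall x, Omega x ->
          \int[lebesgue_measure]_(t in `]0, T[) (u t x * derive1 theta t) =
          - \int[lebesgue_measure]_(t in `]0, T[) (ut t x * theta t)}].

(* u_t + delta(t) Delta^2 u = k(t) h, clamped at the boundary.  As [h] is a
   composite with an arbitrary function, only its class modulo null sets is
   required to be square-integrable. *)
Definition strong_solution T Omega (delta k : R -> R) h u :=
  [/\ C_sobolev0 2 T Omega u,
      exists2 g, L2_L2 T Omega g &
        {ae lebesgue_spacetime, forall p, cylinder T Omega p ->
          h p.1 p.2 = g p.1 p.2} &
      exists D ut,
        [/\ L2_sobolev 4 T Omega u D, W12_L2 T Omega u ut &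
            {ae lebesgue_spacetime, forall p, cylinder T Omega p ->
              ut p.1 p.2 + delta p.1 * bilaplacian (D p.1) p.2 =
              k p.1 * h p.1 p.2}]].

Definition nonneg_solution (tstar : \bar R) Omega
    (delta1 delta2 k1 k2 f1 f2 : R -> R) (u0 v0 : 'rV[R]_N -> R)
    (u v : R -> 'rV[R]_N -> R) :=
  [/\ forall T, 0 < T -> (T%:E < tstar)%E ->
        strong_solution T Omega delta1 k1 (fun t x => f1 (v t x)) u /\
        strong_solution T Omega delta2 k2 (fun t x => f2 (u t x)) v,
      forall t, 0 < t -> (t%:E < tstar)%E ->
        ae_nonneg Omega (u t) /\ ae_nonneg Omega (v t),
      {ae lebesgue_rV N, forall x, Omega x -> u 0 x = u0 x} &
      {ae lebesgue_rV N, forall x, Omega x -> v 0 x = v0 x}].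

Definition Psi Omega (phi1 : 'rV[R]_N -> R) (u v : R -> 'rV[R]_N -> R) (t : R) : R :=
  \int[lebesgue_rV N]_(x in Omega) (u t x * phi1 x) +
  \int[lebesgue_rV N]_(x in Omega) (v t x * phi1 x).

End evolution.

Section constants.
Context {R : realType}.
Implicit Types (tstar : \bar R) (a : R -> R).

Definition life_span tstar : set R := [set t | 0 < t /\ (t%:E < tstar)%E].

Definition positive_bounded tstar a :=
  (forall t, life_span tstar t -> 0 < a t) /\
  exists M, forall t, life_span tstar t -> a t <= M.

Definition delta_max tstar (delta1 delta2 : R -> R) : R :=
  Num.max (sup (delta1 @` life_span tstar)) (sup (delta2 @` life_span tstar)).

Definition c_bar (p : R) tstar N (Omega : set 'rV[R]_N) (k1 k2 : R -> R) : R :=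
  2 `^ (1 - p) * fine (lebesgue_rV N Omega) `^ (- ((p - 1) / 2)) *
  Num.min (inf (k1 @` life_span tstar)) (inf (k2 @` life_span tstar)).

Definition T_bar (p delta Lambda1 c Psi0 : R) : R :=
  - (1 / ((p - 1) * delta * Lambda1) *
     ln (1 - delta * Lambda1 / (c * Psi0 `^ (p - 1)))).

Definition unbounded_at_left (F : R -> R) (t : R) :=
  forall M e, 0 < e -> exists2 s, t - e < s < t & M < F s.

End constants.

(* Main.v *)
Require Import Defs.
From mathcomp Require Import all_boot all_order all_algebra.
From mathcomp Require Import all_classical all_reals all_analysis.
From mathcomp Require Import measurable_realfun ring lra.
Set Implicit Arguments.
Unset Strict Implicit.
Unset Printing Implicit Defensive.
Import Order.TTheory GRing.Theory Num.Theory.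
Import numFieldNormedType.Exports.
Local Open Scope classical_set_scope.
Local Open Scope ring_scope.

(* Testing the system against [phi1] and moving the bilaplacian onto [phi1],
   Jensen's inequality for the measure [phi1 dx] gives, in the sense of
   distributions on (0, T),
     Psi' >= F(Psi),   F(y) = cbar * y^p - delta * Lambda1 * y.
   The hypothesis on Psi(0) says that Psi starts above the positive zero of F, so
   that Psi is nondecreasing, and comparison with y' = F(y) bounds T by the
   blow-up time of y, which is Tbar.  That Lambda1 > 0 uses the sign of phi1: if
   Lambda1 = 0 then Delta phi1 = 0, and pairing with x_i^2 shows that phi1 has
   mean zero. *)

(** [Psi] is merely continuous, with a weak derivative [b] made of the moments of u_t and v_t, and b
    >= F(Psi) holds for almost every time. The comparison is therefore made not with [Psi] itself
    but with its C^1 minorant, [Psi 0] plus the integral of F(Psi) from 0. The two factors of cbar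
    have separate origins. The power of the volume of Omega comes from bounding the integral of phi1
    by the square root of that volume. The factor 2^(1-p) comes from merging the two moments into
    one, with tangent lines to y^p at a point common to both. Positivity of Lambda1 serves to
    replace each delta_i by the upper bound delta, and to divide by delta * Lambda1 in Tbar. The
    bound T <= Tbar, valid for every T below t*, makes t* finite. Blow-up at t* is read as
    unboundedness of Psi to the left of t*, which monotonicity turns into a limit. *)

(** * Square-integrable functions: products, Cauchy-Schwarz, limits of pairings *)

Section square_integrable_theory.
Context {R : realType} d (T : measurableType d) (mu : {measure set T -> \bar R}).
Variables (D : set T) (mD : measurable D).
Implicit Types f g : T -> R.
Local Notation L2 := (square_integrable mu D).

Lemma square_integrable_mul f g : L2 f -> L2 g ->
  mu.-integrable D (fun x => (f x * g x)%:E).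
Proof.
move=> [mf if2] [mg ig2]; apply: le_integrable (integrableD mD if2 ig2) => //.
  by apply/measurable_EFinP; exact: measurable_funM.
move=> x _ /=. rewrite lee_fin normrM.
rewrite [leRHS]ger0_norm ?addr_ge0 ?sqr_ge0//.
rewrite -(real_normK (num_real (f x))) -(real_normK (num_real (g x))).
have := sqr_ge0 (`|f x| - `|g x|); have := normr_ge0 (f x).
have := normr_ge0 (g x); nra.
Qed.

Lemma square_integrableD f g : L2 f -> L2 g -> L2 (fun x => f x + g x).
Proof.
move=> Lf Lg; have [mf if2] := Lf; have [mg ig2] := Lg.
split; first exact: measurable_funD.
have ifg := square_integrable_mul Lf Lg.
apply: eq_integrable (integrableD mD (integrableD mD if2 ig2)
  (integrableZl mD 2 ifg)) => // x _ /=.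
by congr EFin; ring.
Qed.

Lemma square_integrableZ k f : L2 f -> L2 (fun x => k * f x).
Proof.
move=> [mf if2]; split; first exact: measurable_funM.
apply: eq_integrable (integrableZl mD (k ^+ 2) if2) => // x _ /=.
by congr EFin; ring.
Qed.

Lemma square_integrableB f g : L2 f -> L2 g -> L2 (fun x => f x - g x).
Proof.
move=> Lf Lg.
rewrite (_ : (fun x => _) = fun x => f x + (-1) * g x); last first.
  by apply/funext => x; rewrite mulN1r.
by apply: square_integrableD => //; exact: square_integrableZ.
Qed.

Lemma square_integrable0 : L2 (fun=> 0).
Proof.
split; first exact: measurable_cst.
by apply: eq_integrable (integrable0 mu D) => // x _; rewrite expr0n.
Qed.

Lemma square_integrable_sum I (s : seq I) (f : I -> T -> R) :
  (forall i, L2 (f i)) -> L2 (fun x => \sum_(i <- s) f i x).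
Proof.
move=> Lf; elim: s => [|i s IH].
  by under eq_fun do rewrite big_nil; exact: square_integrable0.
by under eq_fun do rewrite big_cons; exact: square_integrableD.
Qed.

Lemma square_integrable_bounded f M : (mu D < +oo)%E -> measurable_fun D f ->
  (forall x, D x -> `|f x| <= M) -> L2 f.
Proof.
move=> muD mf fM; split => //.
apply: measurable_bounded_integrable => //; first exact: measurable_funX.
exists (M ^+ 2); split; first exact: num_real.
move=> K MK x Dx; apply: le_trans (ltW MK).
rewrite normrX lerXn2r ?nnegrE ?normr_ge0 ?fM//.
by apply: le_trans (fM _ Dx); exact: normr_ge0.
Qed.

Lemma Rintegral_sqr_ge0 f : 0 <= \int[mu]_(x in D) (f x ^+ 2).
Proof. by apply: Rintegral_ge0 => x _; exact: sqr_ge0. Qed.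

(** The integral of [(s * f + t * g) ^+ 2] is a non-negative quadratic form in [s] and [t]; at
    [(b, - c)] it equals [b * (a * b - c ^+ 2)]. *)
Lemma Rintegral_cauchy_schwarz f g : L2 f -> L2 g ->
  (\int[mu]_(x in D) (f x * g x)) ^+ 2 <=
  \int[mu]_(x in D) (f x ^+ 2) * \int[mu]_(x in D) (g x ^+ 2).
Proof.
move=> Lf Lg; have [mf if2] := Lf; have [mg ig2] := Lg.
have ifg := square_integrable_mul Lf Lg.
set a := \int[mu]_(x in D) (f x ^+ 2); set b := \int[mu]_(x in D) (g x ^+ 2).
set c := \int[mu]_(x in D) (f x * g x).
have a0 : 0 <= a := Rintegral_sqr_ge0 f.
have b0 : 0 <= b := Rintegral_sqr_ge0 g.
have key s t : 0 <= s ^+ 2 * a + 2 * s * t * c + t ^+ 2 * b.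
  apply: le_trans (Rintegral_sqr_ge0 (fun x => s * f x + t * g x)) _.
  rewrite le_eqVlt; apply/orP; left; apply/eqP.
  have i1 : mu.-integrable D (EFin \o (fun x => s ^+ 2 * f x ^+ 2)).
    exact: (integrableZl mD (s ^+ 2) if2).
  have i2 : mu.-integrable D (EFin \o (fun x => 2 * s * t * (f x * g x))).
    exact: (integrableZl mD (2 * s * t) ifg).
  have i3 : mu.-integrable D (EFin \o (fun x => t ^+ 2 * g x ^+ 2)).
    exact: (integrableZl mD (t ^+ 2) ig2).
  rewrite /a /b /c -!RintegralZl// -RintegralD// -RintegralD//; last first.
    exact: (integrableD mD i1 i2).
  by apply: eq_Rintegral => x _; ring.
move: b0; rewrite le_eqVlt => /predU1P[b0|b0]; last first.
  have := key b (- c).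
  have -> : b ^+ 2 * a + 2 * b * (- c) * c + (- c) ^+ 2 * b = b * (a * b - c ^+ 2) by ring.
  by rewrite pmulr_rge0// subr_ge0.
(* For [b = 0] the form is affine in [t]; this [t] gives it the value [- c ^+ 2], so [c]
   vanishes. *)
rewrite -b0 mulr0; have := key (- c) ((a + 1)/2); rewrite -b0.
have -> : (- c) ^+ 2 * a + 2 * (- c) * ((a + 1) / 2) * c + ((a + 1) / 2) ^+ 2 * 0 =
  - c ^+ 2 by field.
by rewrite oppr_ge0.
Qed.

(** By Cauchy-Schwarz, strong convergence implies weak convergence. The filter is arbitrary because
    the lemma serves both for sequences of test functions and for continuity in time. *)
Lemma cvg_Rintegral_mul I (F : set_system I) {FF : Filter F} (fn : I -> T -> R) f g :
  (\forall i \near F, L2 (fn i)) -> L2 f -> L2 g ->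
  (\int[mu]_(x in D) ((fn i x - f x) ^+ 2)%:E)%E @[i --> F] --> 0%E ->
  \int[mu]_(x in D) (fn i x * g x) @[i --> F] --> \int[mu]_(x in D) (f x * g x).
Proof.
move=> Lfn Lf Lg /fine_cvgP[_ /= cvg0].
apply/subr_cvg0; apply/norm_cvg0P.
pose b := \int[mu]_(x in D) (g x ^+ 2).
have cvgs : Num.sqrt (\int[mu]_(x in D) ((fn i x - f x) ^+ 2) * b) @[i --> F] --> 0.
  rewrite -[X in _ --> X](@sqrtr0 R).
  apply: continuous_cvg; first exact: sqrt_continuous.
  by rewrite -[X in _ --> X](mul0r b); apply: cvgM => //; exact: cvg_cst.
apply: squeeze_cvgr (cvg_cst 0) cvgs.
near=> i; rewrite normr_ge0/=.
have Lfi : L2 (fn i) by near: i.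
rewrite -RintegralB//; [|exact: square_integrable_mul..].
under eq_Rintegral do rewrite -mulrBl.
rewrite -sqrtr_sqr ler_wsqrtr//.
by apply: Rintegral_cauchy_schwarz => //; exact: square_integrableB.
Unshelve. all: by end_near. Qed.

End square_integrable_theory.

(** * Measurability of open sets and volume of balls in R^N *)

Section measurable_rV.
Context {R : realType} (N : nat).

Lemma measurable_rV_coord (i : 'I_N) :
  measurable_fun setT (fun x : 'rV[R]_N => x 0 i).
Proof. exact: measurable_matrix_coord. Qed.

Lemma measurable_rV_box (A : 'I_N -> set R) : (forall i, measurable (A i)) ->
  measurable [set x : 'rV[R]_N | forall i, A i (x 0 i)].
Proof.
move=> mA; rewrite (_ : mkset _ = \bigcap_(i in [set: 'I_N])
    ((fun x : 'rV[R]_N => x 0 i) @^-1` A i)); last first.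
  by apply/seteqP; split => x h i; [move=> _; exact: h|exact: h].
apply: fin_bigcap_measurable => // i _.
by rewrite -[X in measurable X]setTI; exact: measurable_rV_coord.
Qed.

(** The sigma-algebra on row vectors is generated by the coordinates, not by the topology, so [U] is
    written as the countable union of the rational cubes that it contains. *)
Lemma open_measurable_rV (U : set 'rV[R]_N) : open U -> measurable U.
Proof.
move=> oU.
pose B (q : 'rV[rat]_N * rat) : set 'rV[R]_N :=
  [set y | forall i, `](ratr (q.1 0 i) - ratr q.2), (ratr (q.1 0 i) + ratr q.2)[%classic (y 0 i)].
pose F q := if pselect (B q `<=` U) is left _ then B q else set0.
rewrite (_ : U = \bigcup_q F q).
  apply: countable_bigcupT_measurable => [|q]; first exact: countableP.
  rewrite /F; case: pselect => _; last exact: measurable0.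
  apply: (@measurable_rV_box
    (fun i => `](ratr (q.1 0 i) - ratr q.2), (ratr (q.1 0 i) + ratr q.2)[%classic)).
  by move=> i; exact: measurable_itv.
apply/seteqP; split => [x Ux|x [q _]]; last first.
  by rewrite /F; case: pselect => // BU; exact: BU.
have /nbhs_ballP[e /= e0 xeU] := open_nbhs_nbhs (conj oU Ux).
(* A point of the cube is within [s] of its centre, which is itself within [s] of [x]; halving [e]
   makes room for both. *)
have [s] := @rat_in_itvoo R 0 (e / 2) (divr_gt0 e0 (ltr0n _ 2)).
rewrite in_itv/= => /andP[s0 se].
have /choice[q qP] : forall i, exists q : rat, ratr q \in `](x 0 i - ratr s), (x 0 i + ratr s)[.
  by move=> i; apply: rat_in_itvoo; lra.
exists (\row_i q i, s) => //.
have Bx : B (\row_i q i, s) x.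
  by move=> i /=; have := qP i; rewrite mxE !in_itv/= => /andP[? ?]; apply/andP; split; lra.
rewrite /F; case: pselect => // -[] y By; apply: xeU; split => // i j.
rewrite ord1 /ball/= ltr_norml; have := By j; have := Bx j.
by rewrite /= !in_itv/= => /andP[? ?] /andP[? ?]; apply/andP; split; lra.
Qed.

Lemma continuous_measurable_rV (f : 'rV[R]_N -> R) :
  continuous f -> measurable_fun setT f.
Proof.
move=> cf; apply: (measurability _ (RGenOInfty.measurableE R)).
move=> _ [_ [a ->] <-]; rewrite setTI; apply: open_measurable_rV.
by move/continuousP : cf; apply; exact: rray_open.
Qed.

Lemma measurable_ball_rV (c : 'rV[R]_N) (r : R) : measurable (ball_rV c r).
Proof.
have mf : measurable_fun setT (fun x : 'rV[R]_N => \sum_(i < N) (x 0 i - c 0 i) ^+ 2).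
  apply: measurable_sum => i; apply: measurable_funX.
  by apply: measurable_funB => //; exact: measurable_rV_coord.
have := mf measurableT _ (measurable_itv `]-oo, (r ^+ 2)[); rewrite setTI.
by congr measurable; apply/seteqP; split => x /=; rewrite in_itv.
Qed.

Lemma ball_rV_itv (c x : 'rV[R]_N) (r : R) i : 0 < r -> ball_rV c r x ->
  c 0 i - r < x 0 i < c 0 i + r.
Proof.
move=> r0; rewrite /ball_rV/= => cx.
have : (x 0 i - c 0 i) ^+ 2 < r ^+ 2.
  apply: le_lt_trans cx; rewrite (bigD1 i)//= lerDl.
  by apply: sumr_ge0 => j _; exact: sqr_ge0.
by move=> cxi; apply/andP; split; nra.
Qed.

Lemma ball_rV_finite (c : 'rV[R]_N) (r : R) : 0 < r ->
  (lebesgue_rV N (ball_rV c r) < +oo)%E.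
Proof.
move=> r0.
pose A (i : 'I_N) : set R := `](c 0 i - r), (c 0 i + r)[%classic.
have mA i : measurable (A i) by exact: measurable_itv.
apply: (@le_lt_trans _ _ (lebesgue_rV N [set x : 'rV[R]_N | forall i, A i (x 0 i)])).
  apply: le_measure; rewrite ?inE; [exact: measurable_ball_rV|exact: measurable_rV_box|].
  by move=> x xB i; rewrite /A/= in_itv/=; exact: ball_rV_itv.
rewrite lebesgue_rV_box//.
have : (\prod_(i < N) (@lebesgue_measure R) (A i) =
    (\prod_(i < N) (c 0 i + r - (c 0 i - r)))%:E)%E.
  rewrite -prodEFin; apply: eq_bigr => i _.
  by rewrite /A lebesgue_measure_itv/= lte_fin ifT ?EFinB//; lra.
by move=> ->; rewrite ltry.
Qed.

End measurable_rV.

(** * Test functions: stability under derivation, boundedness *)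

Section test_functions.
Context {R : realType} {V : normedModType R}.
Implicit Types (f : V -> R) (A : set V) (s : seq V).

Lemma iter_derive_cat s1 s2 f :
  iter_derive (s1 ++ s2) f = iter_derive s1 (iter_derive s2 f).
Proof. by rewrite /iter_derive foldr_cat. Qed.

(** Off the closed support the function vanishes on an open set, hence so do its derivatives. *)
Lemma iter_derive_support s f :
  [set x | iter_derive s f x != 0] `<=` closure [set x | f x != 0].
Proof.
elim: s => [|v s IH] /=; first exact: subset_closure.
move=> x /=; apply: contra_neqP => nx.
have oC : open (~` closure [set x | f x != 0]) by apply/closed_openC/closed_closure.
rewrite (_ : 'D_v (iter_derive s f) x = 'D_v (cst 0 : V -> R) x).
  by rewrite derive_cst.
apply: near_eq_derive; apply: filterS (open_nbhs_nbhs (conj oC nx)) => y ny.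
by apply/eqP; apply: contra_notT ny => /IH.
Qed.

Lemma test_function_iter_derive A s f :
  test_function A f -> test_function A (iter_derive s f).
Proof.
move=> [sf cf fA]; have cl : closure [set x | iter_derive s f x != 0] `<=` closure [set x | f x != 0].
  rewrite [X in _ `<=` X](closure_id _).1; last exact: closed_closure.
  by apply: closureS; exact: iter_derive_support.
split.
- by move=> s' x; rewrite -iter_derive_cat; exact: sf.
- by apply: subclosed_compact cl => //; exact: closed_closure.
- exact: subset_trans fA.
Qed.

Lemma test_function_continuous A f : test_function A f -> continuous f.
Proof. by move=> [sf _ _] x; apply: differentiable_continuous; exact: (sf [::]). Qed.

Lemma test_function_out A f x : test_function A f -> ~ A x -> f x = 0.
Proof.
move=> [_ _ fA] nAx; apply/eqP; apply: contra_notT nAx => fx.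
by apply: fA; exact: subset_closure.
Qed.

Lemma test_function_bounded A f : test_function A f ->
  exists M, forall x, `|f x| <= M.
Proof.
move=> tf; have [_ cf _] := tf.
have := @continuous_compact _ _ f _ (continuous_subspaceT (test_function_continuous tf)) cf.
move=> /compact_bounded[M [_ /(_ (Num.max M 0 + 1))]].
have M1 : M < Num.max M 0 + 1 by rewrite ltr_pwDr// le_max lexx.
move=> /(_ M1) fM; exists (Num.max M 0 + 1) => x.
have [->|fx] := eqVneq (f x) 0.
  by rewrite normr0 addr_ge0// le_max lexx orbT.
by apply: fM; exists x => //; exact: subset_closure.
Qed.

End test_functions.

(** * The integral of a compactly supported partial derivative is zero *)

Section integral_partial.
Context {R : realType}.

Lemma rV_cons_shift n (t : R) (v y : measurableTypeR R * 'rV[R]_n) :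
  rV_cons (t * v.1 + y.1, t *: v.2 + y.2) = t *: rV_cons v + rV_cons y.
Proof.
by apply/rowP => i; rewrite !mxE; case: unliftP => [k|] _ /=; rewrite ?mxE.
Qed.

Lemma continuous_rV_cons n (h : 'rV[R]_n.+1 -> R) : continuous h ->
  (forall x : 'rV[R]_n, continuous (fun a : R => h (rV_cons (a, x)))) /\
  (forall a : R, continuous (fun x : 'rV[R]_n => h (rV_cons (a, x)))).
Proof.
move=> ch; split=> [x|a].
- move=> a0; apply: (@continuous_comp _ _ _ (fun a : R => rV_cons (a, x)) h); last exact: ch.
  apply/cvg_ballP => e e0; apply: filterS (nbhsx_ballx (a0 : R) _ e0) => a a0a.
  by split => // i j; rewrite !mxE; case: unliftP => [k|] _ //=; exact: ballxx.
- move=> x0; apply: (@continuous_comp _ _ _ (fun x => rV_cons (a, x)) h); last exact: ch.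
  have FF := nbhs_filter x0; apply/cvg_ballP => e e0; apply: filterS (nbhsx_ballx x0 _ e0) => x [_ x0x].
  by split => // i j; rewrite !mxE; case: unliftP => [k|] _ /=; [exact: x0x|exact: ballxx].
Qed.

(** Supports are enclosed in cubes because a slice of a cube at a fixed first coordinate is empty or
    a cube with the same [M], which suits the induction on the dimension. *)
Definition rV_cube N (M : R) : set 'rV[R]_N :=
  [set x | forall i, `[(- M), M]%classic (x 0 i)].

Lemma rV_cube_out N M (x : 'rV[R]_N) : ~ rV_cube M x -> exists i, M < `|x 0 i|.
Proof.
move=> /existsNP[i]; rewrite /= in_itv/= => nx; exists i; rewrite ltNge.
by apply: contra_notN nx; rewrite ler_norml.
Qed.

Lemma measurable_rV_cube N M : measurable (@rV_cube N M).
Proof. by apply: (@measurable_rV_box _ _ (fun=> _)) => i; exact: measurable_itv. Qed.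

Lemma continuous_bounded_rV_cube N (h : 'rV[R]_N -> R) M : continuous h ->
  (forall x, ~ rV_cube M x -> h x = 0) -> exists K, forall x, `|h x| <= K.
Proof.
move=> ch h0.
have cC : compact (@rV_cube N M).
  by apply: (@rV_compact R _ (fun=> `[(- M), M]%classic)) => i; exact: segment_compact.
have [K [_ /(_ (Num.max K 0 + 1))]] := compact_bounded (continuous_compact (continuous_subspaceT ch) cC).
have K1 : K < Num.max K 0 + 1 by rewrite ltr_pwDr// le_max lexx.
move=> /(_ K1) hK; exists (Num.max K 0 + 1) => x.
have [Cx|nCx] := pselect (rV_cube M x); first by apply: hK; exists x.
by rewrite h0// normr0 addr_ge0// le_max lexx orbT.
Qed.

Lemma Rintegral_derive_itv (f f' : R -> R) (M : R) :
  (forall x : R, is_derive x 1 f (f' x)) -> continuous f' ->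
  (forall x, M < `|x| -> f x = 0 /\ f' x = 0) ->
  \int[lebesgue_measure]_x f' x = 0.
Proof.
move=> df cf' f0.
(* Beyond [M], so that [f] vanishes at both ends of [[- M', M']], and positive, so that the interval
   is not degenerate. *)
pose M' := Num.max M 0 + 1.
have M'0 : 0 < M' by rewrite ltr_pwDr// le_max lexx orbT.
have MM' : M < M' by rewrite ltr_pwDr// le_max lexx.
have cf x : {for x, continuous f}.
  by apply: differentiable_continuous; apply/derivable1_diffP; exact: ex_derive.
have -> : \int[lebesgue_measure]_x f' x = \int[lebesgue_measure]_(x in `[(- M'), M']) f' x.
  rewrite [RHS]Rintegral_mkcond; apply: eq_Rintegral => x _; rewrite /patch.
  case: ifPn => //; rewrite notin_setE/= in_itv/= => xM.
  apply: (f0 x _).2; apply: (lt_trans MM'); rewrite ltNge.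
  by apply: contra_notN xM; rewrite ler_norml.
rewrite /Rintegral (@continuous_FTC2 _ f' f).
- have [-> _] : f M' = 0 /\ f' M' = 0 by apply: f0; rewrite gtr0_norm.
  have [-> _] : f (- M') = 0 /\ f' (- M') = 0 by apply: f0; rewrite normrN gtr0_norm.
  by rewrite subee.
- by lra.
- exact: continuous_subspaceT.
- split => [x _|//|//]; first exact: ex_derive.
    by apply: cvg_at_right_filter; exact: cf.
  by apply: cvg_at_left_filter; exact: cf.
- by move=> x _; rewrite derive1E; exact: derive_val.
Qed.

Lemma is_derive_rV_cons n (g : 'rV[R]_n.+1 -> R) (v : R * 'rV[R]_n) df (a : R) x :
  is_derive (rV_cons (a, x)) (rV_cons v) g df ->
  h^-1 *: (g (rV_cons (h * v.1 + a, h *: v.2 + x)) - g (rV_cons (a, x))) @[h --> 0^'] --> df.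
Proof.
move=> [/cvg_ex[l gl] gd].
have -> : df = l by rewrite -gd /derive; exact: (cvg_lim _ gl).
apply: cvg_trans gl; apply: near_eq_cvg; near=> h => /=.
by rewrite (rV_cons_shift h v (a, x)).
Unshelve. all: by end_near. Qed.

Lemma is_deriveP (V : normedModType R) (f : V -> R) x v df :
  h^-1 *: (f (h *: v + x) - f x) @[h --> 0^'] --> df -> is_derive x v f df.
Proof.
move=> fl; apply: DeriveDef; first by apply/cvg_ex; exists df.
exact: (cvg_lim _ fl).
Qed.

(** The complement of the closed cube is open, so [g] vanishes near each of its points. *)
Lemma is_derive_out N (j : 'I_N) (g h : 'rV[R]_N -> R) M :
  (forall x, is_derive x (delta_mx 0 j) g (h x)) -> continuous h ->
  (forall x, ~ rV_cube M x -> g x = 0) -> forall x, ~ rV_cube M x -> h x = 0.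
Proof.
move=> gh ch g0 x /rV_cube_out[i xi].
have <- : 'D_(delta_mx 0 j) g x = h x by apply: derive_val.
rewrite -(derive_cst (0 : R) x (delta_mx 0 j)); apply: near_eq_derive.
have cx : {for x, continuous (fun y : 'rV[R]_N => `|y 0 i|)}.
  by apply: continuous_comp; [exact: coord_continuous|exact: norm_continuous].
near=> y; apply: g0 => /(_ i); rewrite /= in_itv/= -ler_norml leNgt => /negP; apply.
by near: y; exact: (cvgr_gt _ cx).
Unshelve. all: by end_near. Qed.

Lemma bounded_integrable d (T : measurableType d) (mu : {measure set T -> \bar R})
    (B : set T) (f : T -> R) K : measurable B -> (mu B < +oo)%E ->
  measurable_fun setT f -> (forall x, `|f x| <= K) -> (forall x, ~ B x -> f x = 0) ->
  mu.-integrable setT (EFin \o f).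
Proof.
move=> mB muB mf fK f0; rewrite (_ : EFin \o f = (EFin \o f) \_ B); last first.
  by apply/funext => p; rewrite /patch; case: ifPn => //=; rewrite notin_setE => /f0 ->.
apply/(integrable_mkcond _ mB); apply: measurable_bounded_integrable => //.
  exact: measurable_funTS.
exists K; split; first exact: num_real.
by move=> L KL x _; apply: le_trans (ltW KL); exact: fK.
Qed.

Lemma rV_cube_finite N M : (lebesgue_rV N (@rV_cube N M) < +oo)%E.
Proof.
rewrite (lebesgue_rV_box (A := fun=> `[(- M), M]%classic)); last first.
  by move=> i; exact: measurable_itv.
rewrite (eq_bigr (fun=> (fine (@lebesgue_measure R `[(- M), M]%classic))%:E)).
  by rewrite prodEFin ltry.
move=> i _; rewrite fineK// ge0_fin_numE//= lebesgue_measure_itv/=.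
by case: ifP => _; rewrite ?ltry// -EFinB ltry.
Qed.

Lemma continuous_integrable_rV N (h : 'rV[R]_N -> R) M : continuous h ->
  (forall x, ~ rV_cube M x -> h x = 0) ->
  (lebesgue_rV N).-integrable setT (EFin \o h).
Proof.
move=> ch h0; have [K hK] := continuous_bounded_rV_cube ch h0.
apply: (bounded_integrable (measurable_rV_cube M) (rV_cube_finite _ M) _ hK h0).
exact: continuous_measurable_rV.
Qed.

(** [lebesgue_rV n.+1] is by definition the image of a product measure under [rV_cons], so this is a
    change of variables. Integrability comes with it, as Fubini's theorem will ask for it. *)
Lemma integral_rV_cons n (h : 'rV[R]_n.+1 -> R) M : continuous h ->
  (forall x, ~ rV_cube M x -> h x = 0) ->
  (lebesgue_measure \x lebesgue_rV n)%E.-integrable setT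
     (fun p : measurableTypeR R * 'rV[R]_n => (h (rV_cons p))%:E) /\
  (\int[lebesgue_rV n.+1]_x (h x)%:E =
   \int[lebesgue_measure \x lebesgue_rV n]_p (h (rV_cons p))%:E)%E.
Proof.
move=> ch h0.
have mh := continuous_measurable_rV ch.
have mhc : measurable_fun setT (fun p : measurableTypeR R * 'rV[R]_n => h (rV_cons p)).
  exact: (measurableT_comp mh (@measurable_rV_cons R n)).
have ih : (lebesgue_measure \x lebesgue_rV n)%E.-integrable setT
     (fun p : measurableTypeR R * 'rV[R]_n => (h (rV_cons p))%:E).
  pose B : set (measurableTypeR R * 'rV[R]_n) := @rV_cons R n @^-1` rV_cube M.
  have mB : measurable B.
    by rewrite -[B]setTI; apply: measurable_rV_cons => //; exact: measurable_rV_cube.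
  have [K hK] := continuous_bounded_rV_cube ch h0.
  apply: (bounded_integrable mB _ mhc (fun p => hK (rV_cons p))).
    exact: (rV_cube_finite n.+1 M).
  by move=> p nB; exact: h0.
split => //.
have := @integral_pushforward _ _ _ _ _ _ (@measurable_rV_cons R n)
  (lebesgue_measure \x lebesgue_rV n)%E setT (EFin \o h).
rewrite preimage_setT => -> //; exact/measurable_EFinP.
Qed.

(* Fubini reduces the claim to the fundamental theorem of calculus when [j] is
   the outermost coordinate, and to the induction hypothesis otherwise. *)
Lemma Rintegral_partial0 N (j : 'I_N) (g h : 'rV[R]_N -> R) M :
  (forall x, is_derive x (delta_mx 0 j) g (h x)) -> continuous h ->
  (forall x, ~ rV_cube M x -> g x = 0) -> \int[lebesgue_rV N]_x h x = 0.
Proof.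
elim: N => [|n IH] in j g h *; first by case: j.
move=> gh ch g0.
have h0 := is_derive_out gh ch g0.
have [ih ihE] := integral_rV_cons ch h0.
rewrite /Rintegral ihE.
have [cha chx] := continuous_rV_cons ch.
have nC (a : R) (x : 'rV[R]_n) : M < `|a| -> ~ rV_cube M (rV_cons (a, x)).
  move=> aM /(_ ord0); rewrite /= mxE unlift_none/= in_itv/= -ler_norml leNgt.
  by rewrite aM.
have nC' (a : R) (x : 'rV[R]_n) : ~ rV_cube M x -> ~ rV_cube M (rV_cons (a, x)).
  by move=> nx xC; apply: nx => i; have := xC (lift ord0 i); rewrite /= mxE liftK.
case: (unliftP ord0 j) => [k jk|j0].
- rewrite -integral12_prod_meas1// /fubini_F integral0_eq// => a _.
  have := IH k (fun x => g (rV_cons (a, x))) (fun x => h (rV_cons (a, x))).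
  have e1 : rV_cons (0, delta_mx 0 k) = delta_mx 0 j :> 'rV[R]_n.+1.
    apply/rowP => i; rewrite jk !mxE; case: unliftP => [l ->|->]/=.
      by rewrite mxE (inj_eq (@lift_inj _ ord0)).
    by rewrite ?eqxx.
  move=> /(_ _ (chx a)) => IHa.
  have : \int[lebesgue_rV n]_x h (rV_cons (a, x)) = 0.
    apply: IHa => [x|x nx]; last by apply: g0; exact: nC'.
    apply: is_deriveP.
    have := @is_derive_rV_cons n g (0, delta_mx 0 k) (h (rV_cons (a, x))) a x.
    rewrite e1 => /(_ (gh _)) /=.
    by under eq_cvg do rewrite mulr0 add0r.
  rewrite /Rintegral => /eqP; rewrite fine_eq0; first by move/eqP.
  by apply: integrable_fin_num => //; exact: (continuous_integrable_rV (chx a) (fun x nx => h0 _ (nC' a x nx))).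
- rewrite -integral21_prod_meas1// /fubini_G integral0_eq// => x _.
  have : \int[lebesgue_measure]_a h (rV_cons (a, x)) = 0.
    apply: (@Rintegral_derive_itv (fun a => g (rV_cons (a, x))) _ M) => [a|//|a aM].
      apply: is_deriveP.
      have := @is_derive_rV_cons n g (1, 0) (h (rV_cons (a, x))) a x.
      have -> : rV_cons (1, 0) = delta_mx 0 j :> 'rV[R]_n.+1.
        apply/rowP => i; rewrite j0 !mxE; case: unliftP => [l ->|->]/=.
          by rewrite mxE.
        by [].
      move=> /(_ (gh _)) /=.
      by under eq_cvg do rewrite scaler0 add0r.
    by split; [exact: g0 (nC _ _ aM)|exact: h0 (nC _ _ aM)].
  rewrite /Rintegral => /eqP; rewrite fine_eq0; first by move/eqP.
  apply: integrable_fin_num => //.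
  have [K hK] := continuous_bounded_rV_cube ch h0.
  apply: (@bounded_integrable _ (measurableTypeR R) (@lebesgue_measure R) `[(- M), M]%classic
    (fun a => h (rV_cons (a, x))) K) => //.
  - by rewrite /= lebesgue_measure_itv/=; case: ifP => _; rewrite ?ltry// -EFinB ltry.
  - exact: continuous_measurable_fun.
  - move=> a; rewrite /= in_itv/= -ler_norml => /negP; rewrite -ltNge => aM.
    exact: h0 (nC _ _ aM).
Qed.

End integral_partial.

(** * Real-valued integrals modulo null sets *)

Section ae_Rintegral.
Context {R : realType} d (T : measurableType d) (mu : {measure set T -> \bar R}).
Variables (D : set T) (mD : measurable D).
Implicit Types f g : T -> R.

Lemma ae_eq_Rintegral f g : measurable_fun D f -> measurable_fun D g ->
  {ae mu, forall x, D x -> f x = g x} ->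
  \int[mu]_(x in D) f x = \int[mu]_(x in D) g x.
Proof.
move=> mf mg fg; congr fine; apply: ae_eq_integral => //.
- exact/measurable_EFinP.
- exact/measurable_EFinP.
- by apply: filterS fg => x fg Dx; congr EFin; exact: fg.
Qed.

Lemma ae_Rintegral_ge0 f : measurable_fun D f ->
  {ae mu, forall x, D x -> 0 <= f x} -> 0 <= \int[mu]_(x in D) f x.
Proof.
move=> mf f0; rewrite (@ae_eq_Rintegral f (fun x => Num.max (f x) 0)) //.
- by apply: Rintegral_ge0 => x _; rewrite le_max lexx orbT.
- by apply: measurable_maxr => //; exact: measurable_cst.
- by apply: filterS f0 => x f0 Dx; rewrite max_l// f0.
Qed.

Lemma ae_le_Rintegral f g : mu.-integrable D (EFin \o f) -> mu.-integrable D (EFin \o g) ->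
  {ae mu, forall x, D x -> f x <= g x} ->
  \int[mu]_(x in D) f x <= \int[mu]_(x in D) g x.
Proof.
move=> fi gi fg; rewrite -subr_ge0 -RintegralB//; apply: ae_Rintegral_ge0.
  by apply: measurable_funB; apply/measurable_EFinP; apply: (measurable_int mu).
by apply: filterS fg => x fg Dx; rewrite subr_ge0 fg.
Qed.

Lemma Rintegral_sum I (s : seq I) (f : I -> T -> R) :
  (forall i, mu.-integrable D (EFin \o f i)) ->
  mu.-integrable D (EFin \o (fun x => \sum_(i <- s) f i x)) /\
  \int[mu]_(x in D) (\sum_(i <- s) f i x) = \sum_(i <- s) \int[mu]_(x in D) f i x.
Proof.
move=> fi; elim: s => [|i s [IHi IH]].
  rewrite (_ : (fun x => _) = fun=> 0); last by apply/funext => x; rewrite big_nil.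
  by rewrite big_nil Rintegral_cst// mul0r; split => //; exact: (integrable0 mu D).
rewrite (_ : (fun x => _) = fun x => f i x + \sum_(j <- s) f j x); last first.
  by apply/funext => x; rewrite big_cons.
by rewrite big_cons -IH -RintegralD//; split => //; exact: (integrableD mD (fi i) IHi).
Qed.

Lemma square_integrable_cst k : (mu D < +oo)%E -> square_integrable mu D (fun=> k).
Proof. by move=> muD; apply: (square_integrable_bounded mD muD (M := `|k|)). Qed.

Lemma square_integrable_integrable f : (mu D < +oo)%E ->
  square_integrable mu D f -> mu.-integrable D (EFin \o f).
Proof.
move=> muD Lf; have := square_integrable_mul mD Lf (square_integrable_cst 1 muD).
by apply: eq_integrable => // x _; rewrite mulr1.
Qed.

(** A non-negative function with zero integral vanishes almost everywhere, and then so does its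
    square. *)
Lemma Rintegral_gt0_sqr f : (mu D < +oo)%E -> square_integrable mu D f ->
  {ae mu, forall x, D x -> 0 <= f x} -> \int[mu]_(x in D) (f x ^+ 2) != 0 ->
  0 < \int[mu]_(x in D) f x.
Proof.
move=> muD Lf f0; apply: contra_neqT; have [mf _] := Lf.
have fi := square_integrable_integrable muD Lf.
rewrite -leNgt => If0.
have If : \int[mu]_(x in D) f x = 0.
  by apply/eqP; rewrite eq_le If0 ae_Rintegral_ge0.
have : (\int[mu]_(x in D) `|(f x)%:E| = 0)%E.
  apply/eqP; rewrite -fine_eq0; last by apply: integrable_fin_num => //; exact: integrable_abse.
  have := @ae_eq_Rintegral f (fun x => `|f x|) mf.
  rewrite If => e0; apply/eqP; change (\int[mu]_(x in D) `|f x| = 0).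
  rewrite -e0//; first exact: measurableT_comp.
  by apply: filterS f0 => x f0 Dx; rewrite ger0_norm// f0.
move=> /ae_eq_integral_abs f00.
rewrite (@ae_eq_Rintegral _ (fun=> 0)) ?Rintegral_cst ?mul0r//.
  exact: measurable_funX.
apply: filterS (f00 mD (proj2 (measurable_EFinP _ _) mf)) => x fx0 Dx.
by have [->] := fx0 Dx; rewrite expr0n.
Qed.

End ae_Rintegral.

(** * Weak derivatives and the eigenvalue equation tested on W_0^{2,2} *)

Section sobolev_theory.
Context {R : realType} {N : nat} (Omega : set 'rV[R]_N).
Hypothesis mO : measurable Omega.
Hypothesis finO : (lebesgue_rV N Omega < +oo)%E.
Implicit Types (f g w phi : 'rV[R]_N -> R) (D E : seq 'I_N -> 'rV[R]_N -> R).
Local Notation mu := (lebesgue_rV N).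
Local Notation L2 := (square_integrable mu Omega).

Definition laplacian D (x : 'rV[R]_N) : R := \sum_(i < N) D [:: i; i] x.

Definition jet_cvg D (psi : nat -> 'rV[R]_N -> R) := forall s, (size s <= 2)%N ->
  (\int[mu]_(x in Omega) ((D s x - partials s (psi n) x) ^+ 2)%:E)%E
    @[n --> \oo] --> 0%E.

Lemma jet_sqnorm_cvg k I (F : set_system I) {FF : Filter F}
    (D : I -> seq 'I_N -> 'rV[R]_N -> R) s : (size s <= k)%N ->
  jet_sqnorm k Omega (D i) @[i --> F] --> 0%E ->
  (\int[mu]_(x in Omega) ((D i s x) ^+ 2)%:E)%E @[i --> F] --> 0%E.
Proof.
move=> sk; apply: (squeeze_cvge _ (cvg_cst 0%E)); near=> i.
have t0 s' : (0 <= \int[mu]_(x in Omega) ((D i s' x) ^+ 2)%:E)%E.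
  by apply: integral_ge0 => x _; rewrite lee_fin sqr_ge0.
rewrite t0/= /jet_sqnorm (bigD1 (Ordinal (n:=k.+1) (m := size s) sk))//=.
rewrite (bigD1 (in_tuple s))//= -addeA leeDl// adde_ge0//.
  by apply: sume_ge0 => j _.
by apply: sume_ge0 => j _; apply: sume_ge0.
Unshelve. all: by end_near. Qed.

Lemma test_function_partials s psi : test_function Omega psi ->
  test_function Omega (partials s psi).
Proof. exact: test_function_iter_derive. Qed.

Lemma test_function_L2 psi : test_function Omega psi -> L2 psi.
Proof.
move=> tpsi; have [M psiM] := test_function_bounded tpsi.
apply: (square_integrable_bounded mO finO (M := M)) => //.
by apply: measurable_funTS; apply: continuous_measurable_rV; exact: test_function_continuous tpsi.
Qed.

Lemma sobolev0_jet_cvg w : sobolev0 2 Omega w ->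
  exists D psi, [/\ sobolev_jet 2 Omega w D, forall n, test_function Omega (psi n) & jet_cvg D psi].
Proof.
move=> [D jD [psi tpsi cpsi]]; exists D, psi; split => // s s2.
exact: jet_sqnorm_cvg s2 cpsi.
Qed.

Lemma sobolev_jet_L2 k w D s : sobolev_jet k Omega w D -> (size s <= k)%N -> L2 (D s).
Proof. by move=> [_ /(_ s)] + sk => /(_ sk)[]. Qed.

Lemma sobolev_jet_L2_nil k w D : sobolev_jet k Omega w D -> L2 w.
Proof. by move=> jD; have [<- _] := jD; exact: sobolev_jet_L2 jD _. Qed.

Lemma laplacian_L2 w D : sobolev_jet 2 Omega w D -> L2 (laplacian D).
Proof. by move=> jD; apply: square_integrable_sum => // i; exact: sobolev_jet_L2 jD _. Qed.

Lemma jet_cvg_Rintegral D psi w s g : sobolev_jet 2 Omega w D ->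
  (forall n, test_function Omega (psi n)) -> jet_cvg D psi -> (size s <= 2)%N -> L2 g ->
  \int[mu]_(x in Omega) (g x * partials s (psi n) x) @[n --> \oo] -->
  \int[mu]_(x in Omega) (g x * D s x).
Proof.
move=> jD tpsi cpsi s2 Lg.
under eq_cvg do under eq_Rintegral do rewrite mulrC.
under eq_Rintegral do rewrite mulrC.
apply: cvg_Rintegral_mul => //.
- by near=> n; apply/test_function_L2/test_function_partials/tpsi.
- exact: sobolev_jet_L2 jD _.
- under eq_cvg do under eq_integral do rewrite -sqrrN opprB.
  exact: cpsi.
Unshelve. all: by end_near. Qed.

Lemma jet_cvg_laplacian D psi w g : sobolev_jet 2 Omega w D ->
  (forall n, test_function Omega (psi n)) -> jet_cvg D psi -> L2 g ->
  \int[mu]_(x in Omega) (g x * laplacian (partials ^~ (psi n)) x) @[n --> \oo] -->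
  \int[mu]_(x in Omega) (g x * laplacian D x).
Proof.
move=> jD tpsi cpsi Lg.
have lapE E : (forall i, L2 (E [:: i; i])) ->
    \int[mu]_(x in Omega) (g x * laplacian E x) =
    \sum_(i < N) \int[mu]_(x in Omega) (g x * E [:: i; i] x).
  move=> LE; under eq_Rintegral do rewrite /laplacian mulr_sumr.
  by have [_ ->] := Rintegral_sum mO (index_enum 'I_N)
    (fun i => square_integrable_mul mO Lg (LE i)).
rewrite lapE; last by move=> i; exact: sobolev_jet_L2 jD _.
rewrite (_ : (fun n => _) = fun n => \sum_(i < N) \int[mu]_(x in Omega)
    (g x * partials [:: i; i] (psi n) x)); last first.
  by apply/funext => n; rewrite lapE// => i; apply/test_function_L2/test_function_partials/tpsi.
apply: cvg_big => [x|i _]; first exact: add_continuous.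
exact: (jet_cvg_Rintegral jD tpsi cpsi).
Qed.

Let ord_pairs := [seq (i, j) | i <- index_enum 'I_N, j <- index_enum 'I_N].

Let sum_pairs (F : 'I_N -> 'I_N -> R) :
  \sum_(i < N) \sum_(j < N) F i j = \sum_(p <- ord_pairs) F p.1 p.2.
Proof. by rewrite big_allpairs. Qed.

(** Two of the four derivatives are moved onto [w], with [partials [:: j; j] psi] in the role of the
    test function; the order of directions in [bilaplacian] fits this splitting, and the sign is
    (-1)^2. *)
Lemma weak_bilaplacian w D psi : sobolev_jet 2 Omega w D -> test_function Omega psi ->
  \int[mu]_(x in Omega) (w x * bilaplacian (partials ^~ psi) x) =
  \int[mu]_(x in Omega) (laplacian D x * laplacian (partials ^~ psi) x).
Proof.
move=> jD tpsi; have Lw := sobolev_jet_L2_nil jD.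
have Lt s : L2 (partials s psi) by apply/test_function_L2/test_function_partials.
under eq_Rintegral do rewrite /bilaplacian (sum_pairs (fun i j => partials [:: i; i; j; j] psi _)) mulr_sumr.
have [_ ->] := Rintegral_sum mO ord_pairs
  (fun p => square_integrable_mul mO Lw (Lt [:: p.1; p.1; p.2; p.2])).
under [RHS]eq_Rintegral do rewrite /laplacian mulr_suml (eq_bigr _ (fun i _ => mulr_sumr _ _ _ _))
  (sum_pairs (fun i j => D [:: i; i] _ * partials [:: j; j] psi _)).
have [_ ->] := Rintegral_sum mO ord_pairs (fun p => square_integrable_mul mO
  (sobolev_jet_L2 (s := [:: p.1; p.1]) jD isT) (Lt [:: p.2; p.2])).
apply: eq_bigr => p _; have [_ /(_ [:: p.1; p.1] isT)[_ wD]] := jD.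
have := wD _ (test_function_partials [:: p.2; p.2] tpsi).
by rewrite /= sqrrN expr1n mul1r.
Qed.

(* Weak derivatives are only ever moved onto test functions, so that neither
   their uniqueness nor the symmetry of second derivatives is needed: both sides
   below are limits along the test functions approximating [w]. *)
Lemma eigen_weak Lambda phi E w D psi : eigenpair Omega Lambda phi ->
  sobolev_jet 2 Omega phi E -> sobolev_jet 2 Omega w D ->
  (forall n, test_function Omega (psi n)) -> jet_cvg D psi ->
  Lambda * \int[mu]_(x in Omega) (phi x * w x) =
  \int[mu]_(x in Omega) (laplacian E x * laplacian D x).
Proof.
move=> [_ _ eigen] jE jD tpsi cpsi.
have Lphi := sobolev_jet_L2_nil jE.
have c1 := jet_cvg_laplacian jD tpsi cpsi (laplacian_L2 jE).
have c2 := jet_cvg_Rintegral (s := [::]) jD tpsi cpsi isT Lphi.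
have [D0 _] := jD; rewrite D0 in c2.
apply: cvg_unique c1 => //=.
under eq_cvg do rewrite -(weak_bilaplacian jE (tpsi _)) (eigen _ (tpsi _)).
by apply: cvgMr.
Qed.

Lemma bilaplacian_L2 w D : sobolev_jet 4 Omega w D -> L2 (bilaplacian D).
Proof.
move=> jD; apply: square_integrable_sum => // i; apply: square_integrable_sum => // j.
exact: sobolev_jet_L2 jD _.
Qed.

(** Both functions lie in W_0^{2,2}, so each is approximated in turn. Approximating [w] turns the
    right-hand side into the pairing of the two Laplacians; approximating [phi] by test functions
    [psi n] then allows all four derivatives to pass to [w]. *)
Lemma Rintegral_bilaplacian_eigen Lambda phi w D4 : eigenpair Omega Lambda phi ->
  sobolev0 2 Omega w -> sobolev_jet 4 Omega w D4 ->
  \int[mu]_(x in Omega) (bilaplacian D4 x * phi x) =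
  Lambda * \int[mu]_(x in Omega) (w x * phi x).
Proof.
move=> ephi w0 jD4; have [phi0 _ _] := ephi.
have [D [chi [jD tchi cchi]]] := sobolev0_jet_cvg w0.
have [E [psi [jE tpsi cpsi]]] := sobolev0_jet_cvg phi0.
under [in RHS]eq_Rintegral do rewrite mulrC.
rewrite (eigen_weak ephi jE jD tchi cchi).
under [RHS]eq_Rintegral do rewrite mulrC.
have c1 := jet_cvg_laplacian jE tpsi cpsi (laplacian_L2 jD).
have c2 := jet_cvg_Rintegral (s := [::]) jE tpsi cpsi isT (bilaplacian_L2 jD4).
have [E0 _] := jE; rewrite E0 in c2.
apply: cvg_unique c1 => //=.
(* The jets [D] and [D4] of [w] are never compared directly: both sides equal the integral of [w]
   against the bilaplacian of [psi n]. *)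
suff e n : \int[mu]_(x in Omega) (bilaplacian D4 x * psi n x) =
  \int[mu]_(x in Omega) (laplacian D x * laplacian (partials ^~ (psi n)) x).
  by under eq_cvg do rewrite -e.
rewrite -(weak_bilaplacian jD (tpsi n)).
have Lw := sobolev_jet_L2_nil jD.
have Lt s : L2 (partials s (psi n)) by apply/test_function_L2/test_function_partials.
under eq_Rintegral do rewrite /bilaplacian (sum_pairs (fun i j => D4 [:: i; i; j; j] _)) mulr_suml.
under [RHS]eq_Rintegral do
  rewrite /bilaplacian (sum_pairs (fun i j => partials [:: i; i; j; j] (psi n) _)) mulr_sumr.
have [_ ->] := Rintegral_sum mO ord_pairs (fun p => square_integrable_mul mO
  (sobolev_jet_L2 (s := [:: p.1; p.1; p.2; p.2]) jD4 isT) (Lt [::])).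
have [_ ->] := Rintegral_sum mO ord_pairs
  (fun p => square_integrable_mul mO Lw (Lt [:: p.1; p.1; p.2; p.2])).
apply: eq_bigr => p _; have [_ /(_ [:: p.1; p.1; p.2; p.2] isT)[_ wD]] := jD4.
have := wD _ (tpsi n).
by rewrite /= (_ : (-1) ^+ 4 = 1 :> R) ?mul1r => [->|]; last by ring.
Qed.

End sobolev_theory.

(** * Positivity of an eigenvalue with a non-negative eigenfunction *)

Section first_eigenvalue.
Context {R : realType} {N : nat} (Omega : set 'rV[R]_N) (M : R).
Hypothesis mO : measurable Omega.
Hypothesis OM : Omega `<=` rV_cube M.
Local Notation mu := (lebesgue_rV N).
Local Notation L2 := (square_integrable mu Omega).

Let finO : (mu Omega < +oo)%E.
Proof.
apply: le_lt_trans (rV_cube_finite N M); apply: le_measure; rewrite ?inE//.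
exact: measurable_rV_cube.
Qed.

Let coord_sqr_L2 (i : 'I_N) : L2 (fun x => x 0 i ^+ 2).
Proof.
apply: (square_integrable_bounded mO finO (M := M ^+ 2)).
  by apply: measurable_funTS; apply: measurable_funX; exact: measurable_rV_coord.
move=> x /OM /(_ i); rewrite /= in_itv/= -ler_norml normrX => xM.
by rewrite lerXn2r// nnegrE (le_trans _ xM).
Qed.

Lemma is_derive_coord (i j : 'I_N) (x : 'rV[R]_N) :
  is_derive x (delta_mx 0 j) (fun y : 'rV[R]_N => y 0 i) (i == j)%:R.
Proof.
apply: is_deriveP; apply: cvg_near_cst.
near=> h; rewrite !mxE eqxx/= addrK -[_ *: _]/(h^-1 * _) mulKf//.
by near: h; exact: nbhs_dnbhs_neq.
Unshelve. all: by end_near. Qed.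

Lemma is_derive_test (psi : 'rV[R]_N -> R) j (x : 'rV[R]_N) : test_function Omega psi ->
  is_derive x (delta_mx 0 j) psi (partials [:: j] psi x).
Proof.
move=> [spsi _ _]; apply: DeriveDef => //.
by apply: diff_derivable; exact: (spsi [::]).
Qed.

(** The integrand is the [j]-th partial derivative of x_i^2 d_j psi - 2 [i = j] x_i psi, which is
    compactly supported. Summed over [j], this is Green's identity for x_i^2, whose Laplacian is
    2. *)
Lemma Rintegral_test_green (psi : 'rV[R]_N -> R) i j : test_function Omega psi ->
  \int[mu]_(x in Omega) (x 0 i ^+ 2 * partials [:: j; j] psi x - (i == j)%:R * 2 * psi x) = 0.
Proof.
move=> tpsi; set h := fun x : 'rV[R]_N => _.
have out s x : ~ Omega x -> partials s psi x = 0.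
  by apply: test_function_out; exact: test_function_partials.
have outp x (Ox : ~ Omega x) : psi x = 0 := out [::] x Ox.
rewrite Rintegral_mkcond (_ : h \_ Omega = h); last first.
  apply/funext => x; rewrite /patch; case: ifPn => //; rewrite notin_setE => Ox.
  by rewrite /h out// (outp x Ox) !mulr0 subrr.
apply: (@Rintegral_partial0 _ _ j
  (fun x => x 0 i ^+ 2 * partials [:: j] psi x - (i == j)%:R * 2 * x 0 i * psi x) _ M).
- move=> x.
  have dc := is_derive_coord i j x.
  have dp := is_derive_test j x tpsi.
  have dpp : is_derive x (delta_mx 0 j) (partials [:: j] psi) (partials [:: j; j] psi x).
    by apply: is_derive_test; exact: test_function_partials.
  apply: is_derive_eq.
  rewrite /h /GRing.scale/=; case: (i == j) => /=; ring.
- have cp s : continuous (partials s psi).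
    by apply: (test_function_continuous (A := Omega)); exact: test_function_partials.
  have cc : continuous (fun x : 'rV[R]_N => x 0 i) by exact: coord_continuous.
  rewrite /h => x; apply: (@continuousB _ _ _ (fun x : 'rV[R]_N => x 0 i * x 0 i * partials [:: j; j] psi x)).
    by apply: continuousM; [apply: continuousM; exact: cc|exact: cp].
  by apply: continuousM; [exact: cst_continuous|exact: (cp [::])].
- move=> x nx; have Ox : ~ Omega x by move=> /OM.
  by rewrite out// (outp x Ox) !mulr0 subrr.
Qed.

Lemma Rintegral_laplacian_sqr_coord (psi : 'rV[R]_N -> R) i : test_function Omega psi ->
  \int[mu]_(x in Omega) (x 0 i ^+ 2 * laplacian (partials ^~ psi) x) =
  2 * \int[mu]_(x in Omega) psi x.
Proof.
move=> tpsi; have Lt s : L2 (partials s psi) by apply/test_function_L2/test_function_partials.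
have Lx := coord_sqr_L2 i.
have i1 j : mu.-integrable Omega (EFin \o (fun x : 'rV[R]_N => x 0 i ^+ 2 * partials [:: j; j] psi x)).
  exact: (square_integrable_mul mO Lx (Lt [:: j; j])).
have ipsi := square_integrable_integrable mO finO (Lt [::]).
under eq_Rintegral do rewrite /laplacian mulr_sumr.
have [_ ->] := Rintegral_sum mO (index_enum 'I_N) i1.
rewrite (eq_bigr (fun j => (i == j)%:R * 2 * \int[mu]_(x in Omega) psi x)).
  rewrite (bigD1 i)//= eqxx mul1r big1 ?addr0// => j ij.
  by rewrite eq_sym (negbTE ij) !mul0r.
move=> j _; have := Rintegral_test_green i j tpsi.
rewrite RintegralB//; last exact: (integrableZl mO ((i == j)%:R * 2) ipsi).
by rewrite RintegralZl// => /subr0_eq.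
Qed.

(* If the first eigenvalue vanished, the Laplacian of [phi] would vanish;
   testing against [x_i ^ 2] then shows that [phi] has mean [0]. *)
Lemma eigenvalue_gt0 (i : 'I_N) (Lambda : R) phi : eigenpair Omega Lambda phi ->
  ae_nonneg Omega phi -> 0 < Lambda.
Proof.
move=> ephi phi0; have [sphi phin _] := ephi.
have [E [psi [jE tpsi cpsi]]] := sobolev0_jet_cvg sphi.
have Lphi := sobolev_jet_L2_nil jE.
have := eigen_weak mO finO ephi jE jE tpsi cpsi.
have LE := laplacian_L2 mO jE.
have e0 : 0 <= \int[mu]_(x in Omega) (laplacian E x * laplacian E x).
  by apply: Rintegral_ge0 => x _; rewrite -expr2 sqr_ge0.
have p0 : 0 < \int[mu]_(x in Omega) (phi x * phi x).
  rewrite lt_neqAle eq_sym Rintegral_ge0 ?andbT => [|x _]; last by rewrite -expr2 sqr_ge0.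
  by under eq_Rintegral do rewrite -expr2.
move=> LambdaE; rewrite -(pmulr_lgt0 _ p0) LambdaE lt_neqAle e0 andbT.
apply/negP => /eqP lap0.
have Lx := coord_sqr_L2 i.
have c1 := jet_cvg_laplacian mO finO jE tpsi cpsi Lx.
have L1 := square_integrable_cst mO 1 finO.
have c2 := jet_cvg_Rintegral (s := [::]) mO finO jE tpsi cpsi isT L1.
(* Cauchy-Schwarz with a zero L^2 norm spares the passage through almost everywhere vanishing. *)
have xlap0 : \int[mu]_(x in Omega) (x 0 i ^+ 2 * laplacian E x) = 0.
  apply/eqP; rewrite -sqrf_eq0 eq_le sqr_ge0 andbT.
  apply: (le_trans (Rintegral_cauchy_schwarz mO Lx LE)).
  by under [X in _ * X]eq_Rintegral do rewrite expr2; rewrite -lap0 mulr0.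
have := Rintegral_gt0_sqr mO finO Lphi phi0 phin; rewrite lt_neqAle => /andP[/eqP + _]; apply.
have [E0 _] := jE; rewrite xlap0 in c1; rewrite E0 in c2.
under [RHS]eq_Rintegral do rewrite -[phi _]mul1r.
have : 2 * \int[mu]_(x in Omega) (1 * phi x) = 0.
  apply: cvg_unique c1 => //=.
  under eq_cvg do rewrite (Rintegral_laplacian_sqr_coord i (tpsi _)).
  apply: cvgMr; apply: cvg_trans c2; apply: near_eq_cvg; near=> n.
  by apply: eq_Rintegral => x _; rewrite mul1r.
by move/eqP; rewrite mulf_eq0 pnatr_eq0/= => /eqP ->.
Unshelve. all: by end_near. Qed.

End first_eigenvalue.

(** * A smooth step function on the line *)

Section smooth_step.
Context {R : realType}.

Lemma smooth_closed (V : normedModType R) (K : set (V -> R)) :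
  (forall f, K f -> forall x, differentiable f x) ->
  (forall f v, K f -> K (fun x => 'D_v f x)) -> forall f, K f -> smooth f.
Proof.
move=> Kd KD f Kf s; suff Ks : K (iter_derive s f) by exact: Kd.
by elim: s => //= v s IH; exact: KD.
Qed.

(** [flat 0] is the classical smooth function that vanishes to infinite order at 0. Its derivatives
    bring in powers of 1/x, hence the parameter [k]. *)
Definition flat (k : nat) (x : R) : R := if 0 < x then x^-1 ^+ k * expR (- x^-1) else 0.

Lemma flat_le0 k x : x <= 0 -> flat k x = 0.
Proof. by rewrite /flat leNgt => /negbTE ->. Qed.

Lemma flat_ge0 k x : 0 <= flat k x.
Proof.
rewrite /flat; case: ifPn => // x0.
by rewrite mulr_ge0 ?expR_ge0// exprn_ge0// invr_ge0 ltW.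
Qed.

Lemma flat_gt0 k x : 0 < x -> 0 < flat k x.
Proof. by move=> x0; rewrite /flat x0 mulr_gt0 ?expR_gt0// exprn_gt0// invr_gt0. Qed.

(** With y = 1/x and n = k + 1, the inequality y/n <= exp(y/n) raised to the power n gives y^n <=
    n^n exp(y), that is y^k exp(-y) <= n^n x. *)
Lemma flat_bound k x : flat k x <= k.+1%:R ^+ k.+1 * `|x|.
Proof.
have [x0|x0] := leP x 0; first by rewrite flat_le0// mulr_ge0// exprn_ge0.
rewrite /flat x0 gtr0_norm// expRN.
have y0 : 0 < x^-1 by rewrite invr_gt0.
have n0 : 0 < k.+1%:R :> R by rewrite ltr0n.
rewrite -ler_pdivlMr ?invr_gt0 ?expR_gt0// invrK.
have : (x^-1 / k.+1%:R) ^+ k.+1 <= expR x^-1.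
  have -> : expR x^-1 = expR (x^-1 / k.+1%:R) ^+ k.+1.
    by rewrite -expRM_natl mulrC divfK// gt_eqF.
  apply: lerXn2r; rewrite ?nnegrE ?expR_ge0 ?divr_ge0 ?ltW//.
  by apply: lt_le_trans (expR_ge1Dx _); rewrite ltrDr.
rewrite expr_div_n ler_pdivrMr ?exprn_gt0// => h.
rewrite mulrAC -ler_pdivrMr// -exprSr.
by rewrite mulrC.
Qed.

Lemma is_derive_flat k (x : R) :
  is_derive x 1 (flat k) (flat k.+2 x - k%:R * flat k.+1 x).
Proof.
have [x0|x0|->] := ltgtP x 0.
- rewrite !flat_le0 ?ltW// mulr0 subrr.
  apply: (@near_eq_is_derive _ _ _ (cst 0)).
  near=> y; rewrite flat_le0//; apply: ltW; near: y; exact: lt_nbhsl.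
- have nf : \near x, (fun y => y^-1 ^+ k * expR (- y^-1)) x = flat k x.
    by near=> y; rewrite /flat ifT//; near: y; exact: lt_nbhsr.
  have xn0 : x != 0 by rewrite gt_eqF.
  have d1 : is_derive x 1 (fun y : R => y^-1) (- x^-1 ^+ 2).
    have := is_deriveV xn0 (is_derive_id x 1).
    by rewrite /GRing.scale/= mulr1 exprVn.
  have d2 := @is_deriveX _ _ (fun y : R => y^-1) k x 1 _ d1.
  have d3 : is_derive x 1 (fun y : R => expR (- y^-1)) (expR (- x^-1) * x^-1 ^+ 2).
    have dN : is_derive x 1 (fun y : R => - y^-1) (x^-1 ^+ 2).
      by have := is_deriveN d1; rewrite opprK.
    exact: (is_derive1_comp (is_derive_expR _) dN).
  have := is_deriveM d2 d3; rewrite exprfctE => d4.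
  apply: near_eq_is_derive nf _; apply: is_derive_eq d4 _.
  rewrite /flat x0 /GRing.scale/= !exprS.
  case: (k) => [|n]; rewrite /= ?exprS; ring.
(* At 0 the difference quotient of [flat k] is [flat k.+1], which [flat_bound] sends to 0
   linearly. *)
- rewrite !flat_le0// mulr0 subrr.
  apply: is_deriveP; apply/cvgrPdist_lt => e e0.
  pose C : R := k.+2%:R ^+ k.+2.
  have C0 : 0 < C by rewrite exprn_gt0// ltr0n.
  near=> h; rewrite sub0r normrN addr0 (flat_le0 k (lexx 0)) subr0 -[_ *: 1]/(h * 1) mulr1.
  have -> : h^-1 *: flat k h = flat k.+1 h.
    rewrite /flat; case: ifPn => _; last by rewrite scaler0.
    by rewrite exprS -mulrA.
  rewrite ger0_norm ?flat_ge0//; apply: le_lt_trans (flat_bound _ _) _.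
  rewrite -/C -ltr_pdivlMl//.
  by near: h; apply: dnbhs0_lt; rewrite mulr_gt0// invr_gt0.
Unshelve. all: by end_near. Qed.

(* A class containing [flat 0], closed under derivation. *)
Inductive flat_expr : (R -> R) -> Prop :=
| flat_cst c : flat_expr (fun=> c)
| flat_flat k : flat_expr (flat k)
| flat_add f g : flat_expr f -> flat_expr g -> flat_expr (fun x => f x + g x)
| flat_mul f g : flat_expr f -> flat_expr g -> flat_expr (fun x => f x * g x)
| flat_inv f : (forall x, f x != 0) -> flat_expr f -> flat_expr (fun x => (f x)^-1)
| flat_aff a b f : flat_expr f -> flat_expr (fun x => f (a * x + b)).

Lemma flat_expr_derive f : flat_expr f ->
  exists2 f', flat_expr f' & forall x : R, is_derive x 1 f (f' x).
Proof.
elim=> {f} [c|k|f g fe [f' fe' df] ge [g' ge' dg]|f g fe [f' fe' df] ge [g' ge' dg]|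
    f fn0 fe [f' fe' df]|a b f fe [f' fe' df]].
- by exists (fun=> 0); [exact: flat_cst|move=> x; exact: is_derive_cst].
- exists (fun x => flat k.+2 x + (- k%:R) * flat k.+1 x).
    by apply: flat_add; [|apply: flat_mul; [exact: flat_cst|]]; exact: flat_flat.
  by move=> x; rewrite mulNr; exact: is_derive_flat.
- exists (fun x => f' x + g' x); first exact: flat_add.
  by move=> x; exact: is_deriveD.
- exists (fun x => f x * g' x + g x * f' x).
    by apply: flat_add; exact: flat_mul.
  by move=> x; exact: is_deriveM.
- exists (fun x => (-1) * ((f x)^-1 * ((f x)^-1 * f' x))).
    by do !apply: flat_mul => //; [exact: flat_cst|exact: flat_inv|exact: flat_inv].
  move=> x; have := is_deriveV (fn0 x) (df x).
  by rewrite /GRing.scale/= -exprVn expr2 mulN1r mulNr mulrA.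
- exists (fun x => a * f' (a * x + b)).
    by apply: flat_mul; [exact: flat_cst|exact: flat_aff].
  move=> x; have da : is_derive x 1 (fun y : R => a * y + b) a.
    have d1 : is_derive x 1 (fun y : R => a * y) (a * 1).
      by have := is_deriveZ a (is_derive_id x (1 : R)).
    have := is_deriveD d1 (is_derive_cst b x 1).
    by rewrite addr0 mulr1.
  by rewrite mulrC; exact: (is_derive1_comp (df _) da).
Qed.

Lemma is_derive1_differentiable (f : R -> R) (x df : R) :
  is_derive x 1 f df -> differentiable f x.
Proof. by move=> [+ _]; move/derivable1_diffP. Qed.

Lemma flat_expr_differentiable f : flat_expr f -> forall x : R, differentiable f x.
Proof.
by move=> /flat_expr_derive[f' _ df] x; exact: is_derive1_differentiable (df x).
Qed.

Lemma flat_expr_smooth f : flat_expr f -> smooth f.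
Proof.
apply: smooth_closed f => [f|f v fe]; first exact: flat_expr_differentiable.
have [f' fe' df] := flat_expr_derive fe.
(* [smooth] ranges over all directions of the line, and direction [v] merely scales the ordinary
   derivative by [v]. *)
rewrite (_ : (fun _ => _) = fun x => v * f' x); first by apply: flat_mul; [exact: flat_cst|].
apply/funext => x; rewrite (deriveE v (flat_expr_differentiable fe x)).
have -> : v = v *: (1 : R) by rewrite /GRing.scale/= mulr1.
rewrite linearZ -deriveE; last exact: flat_expr_differentiable.
by rewrite derive_val /GRing.scale/= mulr1.
Qed.

(** Rises from 0 on x <= 1 to 1 on x >= 2. The denominator is positive because x - 1 and 2 - x are
    never both at most 0. *)
Definition step (x : R) : R := flat 0 (x - 1) * (flat 0 (x - 1) + flat 0 (2 - x))^-1.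

Lemma step_den_gt0 x : 0 < flat 0 (x - 1) + flat 0 (2 - x).
Proof.
have [x1|x1] := ltP 1 x.
  by rewrite ltr_pwDl ?flat_ge0// flat_gt0// subr_gt0.
by rewrite ltr_wpDl ?flat_ge0// flat_gt0//; lra.
Qed.

Lemma flat_expr_step : flat_expr step.
Proof.
have f1 : flat_expr (fun x => flat 0 (x - 1)).
  rewrite (_ : (fun x => _) = fun x => flat 0 (1 * x + - 1)).
    exact: flat_aff (flat_flat 0).
  by apply/funext => x; rewrite mul1r.
have f2 : flat_expr (fun x => flat 0 (2 - x)).
  rewrite (_ : (fun x => _) = fun x => flat 0 (-1 * x + 2)).
    exact: flat_aff (flat_flat 0).
  by apply/funext => x; rewrite mulN1r addrC.
apply: flat_mul => //; apply: flat_inv; last exact: flat_add.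
by move=> x; rewrite gt_eqF// step_den_gt0.
Qed.

Lemma step_ge0 x : 0 <= step x.
Proof. by rewrite mulr_ge0 ?flat_ge0// invr_ge0 ltW// step_den_gt0. Qed.

Lemma step_le1 x : x <= 1 -> step x = 0.
Proof. by move=> x1; rewrite /step flat_le0 ?mul0r//; lra. Qed.

Lemma step_ge2 x : 2 <= x -> step x = 1.
Proof.
move=> x2; have := step_den_gt0 x; rewrite /step (@flat_le0 0 (2 - x)); last by lra.
by rewrite addr0 => h; rewrite mulfV// gt_eqF.
Qed.

Lemma step_derive : exists s' : R -> R, [/\ flat_expr s', forall x : R, is_derive x 1 step (s' x),
  forall x, x < 1 \/ 2 < x -> s' x = 0 & exists K, forall x, `|s' x| <= K].
Proof.
have [s' es' ds] := flat_expr_derive flat_expr_step.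
have s'0 x : x < 1 \/ 2 < x -> s' x = 0.
  have <- : 'D_1 step x = s' x by exact: derive_val.
  case=> x1.
  - rewrite -(derive_cst (0 : R) x (1 : R)); apply: near_eq_derive.
    near=> y; rewrite step_le1//; apply: ltW; near: y; exact: lt_nbhsl.
  - rewrite -(derive_cst (1 : R) x (1 : R)); apply: near_eq_derive.
    near=> y; rewrite step_ge2//; apply: ltW; near: y; exact: lt_nbhsr.
exists s'; split => //.
have cs' : {within `[1, 2]%classic, continuous (fun x => `|s' x|)}.
  apply: continuous_subspaceT => x; apply: continuous_comp; last exact: norm_continuous.
  exact: differentiable_continuous (flat_expr_differentiable es' x).
have [c _ cM] := EVT_max (ler1n R 2) cs'.
exists `|s' c| => x; have [x1|x1] := ltP x 1; first by rewrite s'0 ?normr0//; left.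
have [x2|x2] := ltP 2 x; first by rewrite s'0 ?normr0//; right.
by apply: cM; rewrite in_itv/= x1.
Unshelve. all: by end_near. Qed.

End smooth_step.

(** * A continuous function with non-negative distributional derivative is nondecreasing *)

Section weakly_nondecreasing.
Context {R : realType}.
Local Notation leb := (@lebesgue_measure R).

Lemma continuous_integrable_itv (f : R -> R) a b : continuous f ->
  leb.-integrable `[a, b] (EFin \o f).
Proof.
move=> cf; apply: continuous_compact_integrable; first exact: segment_compact.
exact: continuous_subspaceT.
Qed.

(** [c * (F b - F a)] is the integral of [c * f], so the error is the integral of [(w - c) * f]. It
    will be applied with [f] the derivative of a steep step, where [L] is inversely proportional to
    [b - a] and the bound does not degenerate. *)
Lemma Rintegral_approx (w F f : R -> R) (a b c g L : R) : a < b -> continuous w ->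
  (forall x : R, is_derive x 1 F (f x)) -> continuous f -> 0 <= g ->
  (forall x, a <= x <= b -> `|w x - c| <= g) -> (forall x, `|f x| <= L) ->
  `|\int[leb]_(x in `[a, b]) (w x * f x) - c * (F b - F a)| <= g * L * (b - a).
Proof.
move=> ab cw dF cf g0 wc fL.
have ci (h1 h2 : R -> R) : continuous h1 -> continuous h2 ->
    leb.-integrable `[a, b] (EFin \o (fun x => h1 x * h2 x)).
  by move=> c1 c2; apply: continuous_integrable_itv => x; apply: continuousM; [exact: c1|exact: c2].
have cF : continuous F.
  by move=> x; apply: differentiable_continuous; exact: is_derive1_differentiable (dF x).
have FE : F b - F a = \int[leb]_(x in `[a, b]) f x.
  rewrite /Rintegral (@continuous_FTC2 _ f F)//.
  - exact: continuous_subspaceT.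
  - split=> [x _||]; first exact: ex_derive.
      by apply: cvg_at_right_filter; exact: cF.
    by apply: cvg_at_left_filter; exact: cF.
  - by move=> x _; rewrite derive1E; exact: derive_val.
rewrite FE -RintegralZl//; last exact: continuous_integrable_itv.
rewrite -RintegralB//; [|exact: ci|exact: (ci (fun=> c) f (@cst_continuous _ _ c))].
under eq_Rintegral do rewrite -mulrBl.
have cwc : continuous (fun x => w x - c).
  by move=> x; apply: continuousB; [exact: cw|exact: cst_continuous].
apply: le_trans (le_normr_Rintegral _ (ci _ _ cwc cf)) _ => //.
have -> : g * L * (b - a) = \int[leb]_(x in `[a, b]) (g * L).
  rewrite Rintegral_cst//= lebesgue_measure_itv/= lte_fin ab -EFinB/=; ring.
apply: le_Rintegral => //.
- exact: (integrable_norm (ci _ _ cwc cf)).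
- by apply: continuous_integrable_itv; exact: cst_continuous.
- move=> x; rewrite /= in_itv/= => xab; rewrite normrM.
  by apply: ler_pM => //; exact: wc.
Qed.

(* Tested against a smooth plateau that rises just after [s] and falls just
   before [t], the integral is close to [w s - w t]. *)
Lemma weak_nondecreasing (w : R -> R) (T s t : R) : continuous w ->
  (forall theta : R -> R, test_function `]0, T[%classic theta -> (forall x, 0 <= theta x) ->
    \int[leb]_(x in `]0, T[) (w x * derive1 theta x) <= 0) ->
  0 <= s -> s < t -> t <= T -> w s <= w t.
Proof.
move=> cw wT s0 st tT.
have [s' [es' ds' s'0 [K s'K]]] := @step_derive R.
have K0 : 0 <= K by apply: le_trans (s'K 0); exact: normr_ge0.
apply/ler_addgt0Pr => e e0.
(* Each flank of the plateau contributes an error of at most g (K / E) (3 E) = 3 g K, which this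
   choice keeps below e / 2 whatever the width [E]. *)
pose g := e / (6 * (K + 1)).
have g0 : 0 < g by rewrite divr_gt0// mulr_gt0// ltr_wpDl.
have [d d0 wd] : exists2 d : R, 0 < d & forall x, (`|x - s| <= d -> `|w x - w s| <= g) /\
    (`|x - t| <= d -> `|w x - w t| <= g).
  have [d1 /= d10 wd1] : \forall x \near s, `|w s - w x| < g.
    by move/cvgrPdist_lt : (cw s); exact.
  have [d2 /= d20 wd2] : \forall x \near t, `|w t - w x| < g.
    by move/cvgrPdist_lt : (cw t); exact.
  exists (Num.min d1 d2 / 2); first by rewrite divr_gt0// lt_min d10 d20.
  have [m1 m2] : Num.min d1 d2 / 2 < d1 /\ Num.min d1 d2 / 2 < d2.
    by have [|] := leP d1 d2; split; lra.
  move=> x; split=> xd; rewrite distrC ltW//.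
  - by apply: wd1; rewrite /ball_/= distrC (le_lt_trans xd).
  - by apply: wd2; rewrite /ball_/= distrC (le_lt_trans xd).
(* Each flank occupies an interval of length 3 E: [3 * E <= d] keeps [w] within [g] of its end value
   there, and [6 * E <= t - s] keeps the two flanks apart. *)
have [E [E0 Ed Est]] : exists E : R, [/\ 0 < E, 3 * E <= d & 6 * E <= t - s].
  exists (Num.min (d / 3) ((t - s) / 6)); split.
  - by rewrite lt_min divr_gt0//= divr_gt0// subr_gt0.
  - by rewrite mulrC -ler_pdivlMr// ge_min lexx.
  - by rewrite mulrC -ler_pdivlMr// ge_min lexx orbT.
have Ei0 : 0 < E^-1 by rewrite invr_gt0.
have EE : E^-1 * E = 1 by rewrite mulVf// gt_eqF.
(* These are [step] at (x - s) / E and at (t - x) / E, written in the affine form of [flat_aff]. *)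
pose A x := step (E^-1 * x + - (E^-1 * s)); pose A' x := E^-1 * s' (E^-1 * x + - (E^-1 * s)).
pose B x := step (- E^-1 * x + E^-1 * t); pose B' x := - E^-1 * s' (- E^-1 * x + E^-1 * t).
have daff a b (f f' : R -> R) : (forall x : R, is_derive x 1 f (f' x)) ->
    forall x : R, is_derive x 1 (fun x => f (a * x + b)) (a * f' (a * x + b)).
  move=> df x; have d1 : is_derive x 1 (fun y : R => a * y) (a * 1).
    by have := is_deriveZ a (is_derive_id x (1 : R)).
  have := is_deriveD d1 (is_derive_cst b x 1); rewrite addr0 mulr1 => da.
  by rewrite mulrC; exact: (is_derive1_comp (df _) da).
have dA : forall x : R, is_derive x 1 A (A' x) by exact: daff.
have dB : forall x : R, is_derive x 1 B (B' x) by exact: daff.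
have ec f : flat_expr f -> continuous f.
  by move=> ef x; apply: differentiable_continuous; exact: flat_expr_differentiable.
have eA : flat_expr A by exact: flat_aff flat_expr_step.
have eB : flat_expr B by exact: flat_aff flat_expr_step.
have cA' : continuous A' by apply: ec; apply: flat_mul; [exact: flat_cst|exact: flat_aff].
have cB' : continuous B' by apply: ec; apply: flat_mul; [exact: flat_cst|exact: flat_aff].
have A'K x : `|A' x| <= E^-1 * K by rewrite /A' normrM (gtr0_norm Ei0) ler_pM2l.
have B'K x : `|B' x| <= E^-1 * K by rewrite /B' normrM normrN (gtr0_norm Ei0) ler_pM2l.
have argA x : E^-1 * x + - (E^-1 * s) = (x - s) / E by rewrite mulrBl; ring.
have argB x : - E^-1 * x + E^-1 * t = (t - x) / E by rewrite mulrBl; ring.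
have A0 x : x <= s + E -> A x = 0.
  by move=> h; rewrite /A argA step_le1// ler_pdivrMr//; lra.
have A1 x : s + 3 * E <= x -> A x = 1.
  by move=> h; rewrite /A argA step_ge2// ler_pdivlMr//; lra.
have B0 x : t - E <= x -> B x = 0.
  by move=> h; rewrite /B argB step_le1// ler_pdivrMr//; lra.
have B1 x : x <= t - 3 * E -> B x = 1.
  by move=> h; rewrite /B argB step_ge2// ler_pdivlMr//; lra.
have A'0 x : x < s + E \/ s + 2 * E < x -> A' x = 0.
  move=> h; rewrite /A' argA s'0 ?mulr0// ltr_pdivrMr// ltr_pdivlMr//.
  by case: h => h; [left|right]; lra.
have B'0 x : x < t - 2 * E \/ t - E < x -> B' x = 0.
  move=> h; rewrite /B' argB s'0 ?mulr0// ltr_pdivrMr// ltr_pdivlMr//.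
  by case: h => h; [right|left]; lra.
have A0s : A s = 0 by apply: A0; rewrite lerDl ltW.
have A1s : A (s + 3 * E) = 1 by exact: A1.
have B0t : B t = 0 by apply: B0; rewrite gerBl ltW.
have B1t : B (t - 3 * E) = 1 by exact: B1.
pose th x := A x * B x; pose th' x := A x * B' x + B x * A' x.
have dth (x : R) : is_derive x 1 th (th' x) by exact: is_deriveM.
have th_out x : th x != 0 -> s + E <= x <= t - E.
  move=> thx; rewrite leNgt [X in _ && X]leNgt; apply/andP; split; apply: contraNN thx => h.
  - by rewrite /th A0 ?mul0r// ltW.
  - by rewrite /th B0 ?mulr0// ltW.
have tth : test_function `]0, T[%classic th.
  have cl : closure [set x | th x != 0] `<=` `[s + E, t - E]%classic.
    rewrite [X in _ `<=` X](closure_id _).1; last exact: itv_closed.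
    by apply: closureS => x /th_out; rewrite /= in_itv.
  split.
  - by apply: flat_expr_smooth; exact: flat_mul.
  - apply: (@subclosed_compact _ _ `[s + E, t - E]%classic) => //.
      exact: closed_closure.
    exact: segment_compact.
  - move=> x /cl; rewrite /= !in_itv/= => /andP[? ?].
    by apply/andP; split; lra.
have := wT _ tth (fun x => mulr_ge0 (step_ge0 _) (step_ge0 _)).
pose I1 := `[s, s + 3 * E]%classic : set R; pose I2 := `[t - 3 * E, t]%classic : set R.
have i1 : leb.-integrable I1 (EFin \o (fun x => w x * A' x)).
  by apply: continuous_integrable_itv => x; apply: continuousM; [exact: cw|exact: cA'].
have i2 : leb.-integrable I2 (EFin \o (fun x => w x * B' x)).
  by apply: continuous_integrable_itv => x; apply: continuousM; [exact: cw|exact: cB'].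
(* Where one of [A'], [B'] is non-zero the other factor of the plateau equals 1, so the derivative
   of [th] is [A' + B'], supported on the two flanks. *)
have -> : \int[leb]_(x in `]0, T[) (w x * derive1 th x) =
    \int[leb]_(x in I1) (w x * A' x) + \int[leb]_(x in I2) (w x * B' x).
  have res D (f : R -> R) : measurable D -> leb.-integrable D (EFin \o f) ->
      leb.-integrable setT (EFin \o (f \_ D)).
    by move=> mD fi; rewrite -restrict_EFin; apply/(integrable_mkcond _ mD).
  rewrite (@Rintegral_mkcond _ _ _ leb I1) (@Rintegral_mkcond _ _ _ leb I2)
    (@Rintegral_mkcond _ _ _ leb `]0, T[%classic).
  rewrite -RintegralD//; [|exact: res (measurable_itv _) i1|exact: res (measurable_itv _) i2].
  apply: eq_Rintegral => x _; rewrite /patch.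
  have -> : derive1 th x = th' x by rewrite derive1E; exact: derive_val.
  have -> : (if x \in I1 then w x * A' x else 0) = w x * A' x.
    case: ifPn => //; rewrite notin_setE /I1/= in_itv/= => xI; rewrite A'0 ?mulr0//.
    have [|h] := ltP x (s + E); [by left|right; rewrite ltNge; apply: contra_notN xI => h'].
    by apply/andP; split; lra.
  have -> : (if x \in I2 then w x * B' x else 0) = w x * B' x.
    case: ifPn => //; rewrite notin_setE /I2/= in_itv/= => xI; rewrite B'0 ?mulr0//.
    have [|h] := ltP (t - E) x; [by right|left; rewrite ltNge; apply: contra_notN xI => h'].
    by apply/andP; split; lra.
  rewrite /th'; case: ifPn => [_|]; last first.
    rewrite notin_setE/= in_itv/= => xI.
    have xst : x <= s \/ t <= x.
      have [|h] := leP x s; [by left|right; rewrite leNgt; apply: contra_notN xI => h'].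
      by apply/andP; split; lra.
    have -> : A' x = 0 by apply: A'0; case: xst => h; [left|right]; lra.
    have -> : B' x = 0 by apply: B'0; case: xst => h; [left|right]; lra.
    by rewrite !mulr0 addr0.
  have [h|h] := leP x (s + 3 * E).
    have -> : B x = 1 by apply: B1; lra.
    have -> : B' x = 0 by apply: B'0; left; lra.
    by rewrite !mulr0 add0r mul1r addr0.
  have -> : A x = 1 by apply: A1; lra.
  have -> : A' x = 0 by apply: A'0; right; lra.
  by rewrite !mulr0 addr0 mul1r add0r.
have l1 : s + 3 * E - s = 3 * E by lra.
have l2 : t - (t - 3 * E) = 3 * E by lra.
have w1 x : s <= x <= s + 3 * E -> `|w x - w s| <= g.
  by move=> /andP[? ?]; apply: (wd x).1; rewrite ger0_norm; lra.
have w2 x : t - 3 * E <= x <= t -> `|w x - w t| <= g.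
  by move=> /andP[? ?]; apply: (wd x).2; rewrite ler0_norm; lra.
have ss : s < s + 3 * E by lra.
have tt : t - 3 * E < t by lra.
have a1 := @Rintegral_approx w A A' s (s + 3 * E) (w s) g (E^-1 * K).
have a2 := @Rintegral_approx w B B' (t - 3 * E) t (w t) g (E^-1 * K).
rewrite A0s A1s subr0 mulr1 in a1; rewrite B0t B1t sub0r mulrN1 in a2.
have gK : g * (E^-1 * K) * (3 * E) <= e / 2.
  rewrite (_ : _ * (3 * E) = 3 * g * K * (E^-1 * E)); last by ring.
  rewrite EE mulr1 /g.
  rewrite (_ : 3 * (e / (6 * (K + 1))) * K = (e / 2) * (K / (K + 1))); last first.
    by field; rewrite gt_eqF// ltr_wpDl.
  by rewrite ler_piMr ?divr_ge0 ?(ltW e0)// ler_pdivrMr ?ltr_wpDl// mul1r lerDl.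
rewrite l1 in a1; rewrite l2 in a2.
have /ler_normlP[+ _] := a1 ss cw dA cA' (ltW g0) w1 A'K.
have /ler_normlP[+ _] := a2 tt cw dB cB' (ltW g0) w2 B'K.
move: gK; clear -R; lra.
Qed.

End weakly_nondecreasing.

(** * The weak inequality Psi' >= F(Psi) and its maximal existence time *)

Section blowup_inequality.
Context {R : realType}.
Local Notation leb := (@lebesgue_measure R).

Lemma ae_lebesgueS2 (P1 P2 Q : measurableTypeR R -> Prop) :
  (forall t, P1 t -> P2 t -> Q t) ->
  {ae leb, forall t, P1 t} -> {ae leb, forall t, P2 t} -> {ae leb, forall t, Q t}.
Proof. exact: filterS2. Qed.

(** The truncation keeps clear of the default value of the power at negative arguments; it leaves
    the non-negative function [P] unchanged. *)
Lemma continuous_powR_pos (p : R) : 0 < p -> continuous (fun y : R => Num.max y 0 `^ p).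
Proof.
move=> p0 y; have [y0|y0|->] := ltgtP y 0.
- have cc : (fun=> Num.max y 0 `^ p) z @[z --> y] --> Num.max y 0 `^ p by exact: cvg_cst.
  apply: cvg_trans cc; apply: near_eq_cvg; near=> z.
  by rewrite /= !max_r ?ltW//; near: z; exact: lt_nbhsl.
- have cp : z `^ p @[z --> y] --> Num.max y 0 `^ p.
    rewrite max_l ?ltW//; exact: (differentiable_continuous (is_derive1_differentiable (is_derive1_powR p y0))).
  apply: cvg_trans cp; apply: near_eq_cvg; near=> z.
  by rewrite max_l// ltW//; near: z; exact: lt_nbhsr.
- rewrite /continuous_at (max_l (lexx (0 : R))) powR0 ?gt_eqF//; apply/cvgrPdist_lt => e e0.
  have d0 : 0 < e `^ p^-1 by exact: powR_gt0.
  have nz : \forall z \near (0 : R), `|z| < e `^ p^-1 by exact: nbhs0_lt.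
  apply: filterS nz => z nz; rewrite sub0r normrN ger0_norm ?powR_ge0//.
  have zd : Num.max z 0 < e `^ p^-1.
    by rewrite gt_max d0 andbT; apply: le_lt_trans (ler_norm _) nz.
  have -> : e = (e `^ p^-1) `^ p by rewrite -powRrM mulVf ?gt_eqF// powRr1// ltW.
  by apply: gt0_ltr_powR; rewrite // nnegrE ?le_max ?lexx ?orbT// ltW.
Unshelve. all: by end_near. Qed.

Lemma Rintegral_oo_cc (f : R -> R) a b : continuous f ->
  \int[leb]_(x in `]a, b[) f x = \int[leb]_(x in `[a, b]) f x.
Proof.
move=> cf; have fi := continuous_integrable_itv a b cf.
rewrite Rintegral_itv_bndo_bndc ?Rintegral_itv_obnd_cbnd//.
- by apply: integrableS fi => //; exact: subset_itv_oc_cc.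
- by apply: integrableS fi => //; exact: subset_itv_oo_cc.
Qed.

Lemma test_function_derive1 A (th : R -> R) : test_function A th ->
  continuous (derive1 th) /\ forall x : R, is_derive x 1 th (derive1 th x).
Proof.
move=> tth; split=> x.
  have -> : derive1 th = iter_derive [:: 1 : R] th by apply/funext => y; rewrite derive1E.
  by have := test_function_continuous (test_function_iter_derive [:: 1 : R] tth); exact.
apply: DeriveDef; last by rewrite derive1E.
by have [sth _ _] := tth; apply: diff_derivable; exact: (sth [::]).
Qed.

Lemma is_derive_oo_LR (F f : R -> R) (a b : R) : a < b ->
  (forall x : R, a <= x <= b -> is_derive x 1 F (f x)) ->
  derivable_oo_LRcontinuous F a b /\ {in `]a, b[, derive1 F =1 f}.
Proof.
move=> ab dF; have cF x : a <= x <= b -> F y @[y --> x] --> F x.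
  by move=> xab; exact: (differentiable_continuous (is_derive1_differentiable (dF x xab))).
split; first split.
- by move=> x; rewrite in_itv/= => /andP[ax xb]; apply: ex_derive; apply: dF; rewrite !ltW.
- by apply: cvg_at_right_filter; apply: cF; rewrite lexx ltW.
- by apply: cvg_at_left_filter; apply: cF; rewrite lexx ltW.
- move=> x; rewrite in_itv/= => /andP[ax xb]; rewrite derive1E.
  by have [] := dF x _; rewrite ?ltW.
Qed.

Lemma Rintegral_test_parts (T : R) (Y f th : R -> R) : 0 < T -> continuous f ->
  (forall x : R, 0 <= x <= T -> is_derive x 1 Y (f x)) -> test_function `]0, T[%classic th ->
  \int[leb]_(x in `[0, T]) (Y x * derive1 th x) = - \int[leb]_(x in `[0, T]) (f x * th x).
Proof.
move=> T0 cf dY tth; have [cth' dth] := test_function_derive1 tth.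
have [Y1 Y2] := is_derive_oo_LR T0 dY.
have [t1 t2] := is_derive_oo_LR T0 (fun x _ => dth x).
rewrite (@Rintegration_by_parts _ Y th f)//.
- rewrite (test_function_out (x := T) tth) ?(test_function_out (x := 0) tth)/= ?in_itv/= ?ltxx ?andbF//.
  by rewrite !mulr0 subrr sub0r.
- exact: continuous_subspaceT.
- exact: continuous_subspaceT.
Qed.

Variables (a c p : R).
Hypotheses (a0 : 0 < a) (c0 : 0 < c) (p1 : 1 < p).

Let F (y : R) : R := c * y `^ p - a * y.
Let ystar : R := (a / c) `^ (1 / (p - 1)).
(** The time that a solution of the Bernoulli equation y' = F(y) takes from y to infinity: the
    antiderivative of -1/F beyond [ystar] that tends to 0 at infinity. The substitution z = y^(1-p),
    which makes the equation linear, yields it. *)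
Let H (y : R) : R := - (1 / ((p - 1) * a) * ln (1 - a / (c * y `^ (p - 1)))).

Let p10 : 0 < p - 1. Proof. by rewrite subr_gt0. Qed.
Let ac0 : 0 < a / c. Proof. exact: divr_gt0. Qed.
Let ystar0 : 0 < ystar. Proof. exact: powR_gt0. Qed.

Let ystarE y : ystar < y -> a < c * y `^ (p - 1).
Proof.
move=> yy; rewrite mulrC -ltr_pdivrMr//.
have -> : a / c = ystar `^ (p - 1).
  by rewrite /ystar -powRrM mul1r mulVf ?gt_eqF// powRr1// ltW.
have y0 : 0 <= y by rewrite ltW// (lt_trans ystar0).
by apply: gt0_ltr_powR; rewrite // nnegrE ?y0 ?(ltW ystar0).
Qed.

Let FE y : 0 <= y -> F y = y * (c * y `^ (p - 1) - a).
Proof.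
move=> y0; have p0 : 0 < p by exact: lt_trans ltr01 p1.
rewrite /F -(@mulr_powRB1 _ y p)//.
by ring.
Qed.

Let F_gt0 y : ystar < y -> 0 < F y.
Proof.
move=> yy; have y0 := lt_trans ystar0 yy.
by rewrite FE ?(ltW y0)// mulr_gt0// subr_gt0 ystarE.
Qed.

Let F_le y z : ystar < y -> y <= z -> F y <= F z.
Proof.
move=> yy yz; have y0 := lt_trans ystar0 yy; have z0 := lt_le_trans y0 yz.
rewrite (FE (ltW y0)) (FE (ltW z0)); apply: ler_pM => //; first exact: ltW.
  by rewrite subr_ge0 ltW// ystarE.
rewrite lerD2r ler_pM2l//; apply: ge0_ler_powR; rewrite ?nnegrE ?(ltW y0) ?(ltW z0)//.
exact: ltW.
Qed.

Let arg_gt0 y : ystar < y -> 0 < 1 - a / (c * y `^ (p - 1)).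
Proof.
move=> yy; have h := ystarE yy; rewrite subr_gt0 ltr_pdivrMr ?mul1r//.
exact: lt_trans h.
Qed.

Let H_ge0 y : ystar < y -> 0 <= H y.
Proof.
move=> yy; rewrite /H oppr_ge0 mulr_ge0_le0//.
  by rewrite divr_ge0// mulr_ge0// ltW.
apply: ln_le0; rewrite gerBl; apply: divr_ge0; first exact: ltW.
by rewrite mulr_ge0 ?powR_ge0// ltW.
Qed.

Let is_derive_H y : ystar < y -> is_derive y 1 H (- (F y)^-1).
Proof.
move=> yy; have y0 := lt_trans ystar0 yy.
have m0 : 0 < y `^ (p - 1) by exact: powR_gt0.
have h := ystarE yy.
have q0 := arg_gt0 yy.
have cm : c * y `^ (p - 1) != 0 by rewrite gt_eqF// mulr_gt0.
have d1 := is_derive1_powR (p - 1) y0.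
have d2 : is_derive y 1 (fun y => c * y `^ (p - 1)) (c * ((p - 1) * y `^ (p - 1 - 1))).
  exact: (is_deriveZ c d1).
have d3 := @is_deriveV _ (fun y => c * y `^ (p - 1)) y _ 1 cm d2.
have d4 := is_deriveZ (- a) d3.
pose q (y : R) := 1 - a / (c * y `^ (p - 1)).
have d5 : is_derive y 1 q (0 + (- a) *: (- (c * y `^ (p - 1)) ^- 2 *: (c * ((p - 1) * y `^ (p - 1 - 1))))).
  have := is_deriveD (is_derive_cst (1 : R) y 1) d4.
  congr is_derive; apply/funext => z.
  by change (1 + - a * (c * z `^ (p - 1))^-1 = q z); rewrite mulNr.
have d6 := @is_derive1_comp _ (@ln R) q y _ _ (is_derive1_ln q0) d5.
have d7 : is_derive y 1 H ((- (1 / ((p - 1) * a))) *: ((1 - a / (c * y `^ (p - 1)))^-1 *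
    (0 + (- a) *: (- (c * y `^ (p - 1)) ^- 2 *: (c * ((p - 1) * y `^ (p - 1 - 1))))))).
  have := is_deriveZ (- (1 / ((p - 1) * a))) d6.
  congr is_derive; apply/funext => z.
  by change (- (1 / ((p - 1) * a)) * ln (q z) = H z); rewrite mulNr.
apply: is_derive_eq d7 _.
rewrite FE ?(ltW y0)//.
have -> : y `^ (p - 1 - 1) = y `^ (p - 1) / y.
  by rewrite powRB ?(gt_eqF y0) ?implybT// powRr1// ltW.
move: (y `^ (p - 1)) m0 h cm => m m0 h cm.
rewrite /GRing.scale/=; field.
by rewrite !gt_eqF// subr_gt0.
Qed.

(** The clamp is the continuous retraction of the line onto [[0, T]], so continuity within the
    interval becomes continuity everywhere. *)
Lemma continuous_clamp (T : R) (f : R -> R) : 0 <= T ->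
  {in `[0, T], forall t0, f t @[t --> within `[0, T]%classic (nbhs t0)] --> f t0} ->
  continuous (fun t => f (Num.max 0 (Num.min t T))).
Proof.
move=> T0 cf t0; pose m (t : R) := Num.max 0 (Num.min t T).
have mI t : m t \in `[0, T].
  by rewrite /m in_itv/= le_max lexx/= ge_max T0/= ge_min lexx orbT.
have cm : continuous m.
  move=> t; apply: (@continuous_max _ _ (cst 0) (fun t => Num.min t T)).
    exact: cst_continuous.
  by apply: (@continuous_min _ _ id (cst T)); [exact: cvg_id|exact: cst_continuous].
apply: (@cvg_comp _ _ _ m f (nbhs t0) (within `[0, T]%classic (nbhs (m t0)))).
  move=> A wA; have : nbhs t0 (m @^-1` [set x | `[0, T]%classic x -> A x]) by exact: cm t0 _ wA.
  by apply: filterS => t /=; apply; exact: mI.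
exact: cf (mI t0).
Qed.

Variables (T : R) (Psi : R -> R).
Hypothesis T0 : 0 < T.
Hypothesis cPsi : {in `[0, T], forall t0, Psi t @[t --> within `[0, T]%classic (nbhs t0)] --> Psi t0}.
Hypothesis Psi_ge0 : forall t, 0 <= t <= T -> 0 <= Psi t.
Hypothesis Psi0 : ystar < Psi 0.
Variable b : R -> R.
Hypothesis Psi_b : {ae leb, forall t, `]0, T[%classic t -> F (Psi t) <= b t}.
Hypothesis weakPsi : forall th : R -> R, test_function `]0, T[%classic th ->
  leb.-integrable `]0, T[ (EFin \o (fun t => b t * th t)) /\
  \int[leb]_(t in `]0, T[) (Psi t * derive1 th t) = - \int[leb]_(t in `]0, T[) (b t * th t).

(* [Psi] is only known on [0, T]; it is extended by constants. *)
Let clamp (t : R) := Num.max 0 (Num.min t T).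

Let clampE (t : R) : 0 <= t <= T -> clamp t = t.
Proof. by move=> /andP[t0 tT]; rewrite /clamp min_l// max_r. Qed.

Let clampI (t : R) : 0 <= clamp t <= T.
Proof. by rewrite le_max lexx/= ge_max (ltW T0)/= ge_min lexx orbT. Qed.

Let P t := Psi (clamp t).
Let cP : continuous P. Proof. by apply: continuous_clamp; first exact: ltW. Qed.
Let P0 t : 0 <= P t. Proof. exact/Psi_ge0/clampI. Qed.
Let f t := F (P t).

Let cf : continuous f.
Proof.
rewrite (_ : f = fun t => c * Num.max (P t) 0 `^ p - a * P t); last first.
  by apply/funext => t; rewrite /f /F max_l.
have p0 : 0 < p := lt_trans ltr01 p1.
have cm : continuous (fun t => Num.max (P t) 0 `^ p).
  move=> t; apply: (@continuous_comp _ _ _ P (fun y => Num.max y 0 `^ p)); first exact: cP.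
  exact: continuous_powR_pos.
move=> t; apply: (@continuousB _ _ _ (fun t => c * Num.max (P t) 0 `^ p) (fun t => a * P t)).
  by apply: continuousM; [exact: cst_continuous|exact: cm].
by apply: continuousM; [exact: cst_continuous|exact: cP].
Qed.

Let weakF th : test_function `]0, T[%classic th -> (forall x, 0 <= th x) ->
  \int[leb]_(t in `]0, T[) (Psi t * derive1 th t) <= - \int[leb]_(t in `]0, T[) (F (Psi t) * th t).
Proof.
move=> tth th0; have [ib ->] := weakPsi tth; rewrite lerN2.
suff iF : leb.-integrable `]0, T[ (EFin \o (fun t => F (Psi t) * th t)).
  apply: (ae_le_Rintegral _ iF ib); first exact: measurable_itv.
  by apply: ae_lebesgueS2 Psi_b Psi_b => t Fb _ tI; rewrite ler_wpM2r// Fb.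
have cfth : continuous (fun t => f t * th t).
  by move=> x; apply: continuousM; [exact: cf|exact: (test_function_continuous tth)].
have i1 : leb.-integrable `]0, T[ (EFin \o (fun t => f t * th t)).
  by apply: integrableS (continuous_integrable_itv 0 T cfth) => //; exact: subset_itv_oo_cc.
apply: eq_integrable i1; first exact: measurable_itv.
move=> t; rewrite inE/= in_itv/= => /andP[t0 tT].
have tE : clamp t = t by apply: clampE; rewrite !ltW.
by rewrite /f /P tE.
Qed.

(** Starting at -1 makes 0 an interior point, so that [Y] has a two-sided derivative on all of
    [[0, T]]; only differences of [Y] matter. *)
Let Y t := \int[leb]_(s in `[-1, t]) f s.

Let dY (t : R) : 0 <= t <= T -> is_derive t 1 Y (f t).
Proof.
move=> /andP[t0 tT].
have tT1 : t < T + 1 by rewrite (le_lt_trans tT)// ltrDl.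
have t1 : -1 < t by rewrite (lt_le_trans _ t0)// ltrN10.
have [d1 d2] := @continuous_FTC1_closed _ f (-1) t (T + 1) tT1
  (continuous_integrable_itv _ _ cf) t1 (@cf t).
by apply: (DeriveDef d1); rewrite -derive1E d2.
Qed.

Let cY : {in `[0, T], forall t0, Y t @[t --> within `[0, T]%classic (nbhs t0)] --> Y t0}.
Proof.
move=> t; rewrite in_itv/= => tT; apply: cvg_within_filter.
exact: (differentiable_continuous (is_derive1_differentiable (dY tT))).
Qed.

(** As Y' = F(Psi), the continuous function Psi - Y has non-negative distributional derivative, and
    [weak_nondecreasing] applies to its clamped extension. *)
Let PsiY (s t : R) : 0 <= s -> s < t -> t <= T -> Psi s - Y s <= Psi t - Y t.
Proof.
move=> s0 st tT.
have cYc := continuous_clamp (ltW T0) cY.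
have cw : continuous (fun t => P t - Y (clamp t)).
  move=> x; apply: (@continuousB _ _ _ P (fun t => Y (clamp t))); [exact: cP|exact: cYc].
have := @weak_nondecreasing _ (fun t => P t - Y (clamp t)) T s t.
rewrite /P !clampE ?s0 ?(le_trans s0 (ltW st)) ?(le_trans (ltW st) tT)//; apply => //.
move=> th tth th0; have [cth' dth] := test_function_derive1 tth.
have cth := test_function_continuous tth.
have cM (g h : R -> R) : continuous g -> continuous h -> continuous (fun x => g x * h x).
  by move=> cg ch x; apply: continuousM; [exact: cg|exact: ch].
have cM1 := cM _ _ cP cth'.
have cM2 := cM _ _ cYc cth'.
have := weakF tth th0.
have inI x : x \in `]0, T[%classic -> 0 <= x <= T.
  by rewrite inE/= in_itv/= => /andP[? ?]; rewrite !ltW.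
rewrite [X in X <= _](@eq_Rintegral _ _ _ leb `]0, T[%classic (fun t => P t * derive1 th t)); last first.
  by move=> x /inI xT; rewrite /P clampE.
rewrite [X in _ <= - X](@eq_Rintegral _ _ _ leb `]0, T[%classic (fun t => f t * th t)); last first.
  by move=> x /inI xT; rewrite /f /P clampE.
rewrite (Rintegral_oo_cc _ _ cM1) (Rintegral_oo_cc _ _ (cM _ _ cf cth)).
rewrite -(Rintegral_test_parts T0 cf dY tth).
rewrite [X in _ <= X](@eq_Rintegral _ _ _ leb `[0, T]%classic
  (fun t => Y (clamp t) * derive1 th t)); last first.
  by move=> x; rewrite inE/= in_itv/= => xT; rewrite clampE.
rewrite Rintegral_oo_cc; last exact: (cM _ _ cw cth').
rewrite -(subr_le0 _ (\int[leb]_(x in `[0, T]) (P x * derive1 th x))) -RintegralB//;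
  [|exact: continuous_integrable_itv..].
by under eq_Rintegral do rewrite -mulrBl.
Qed.

Let Y_le (s t : R) : 0 <= s -> s <= t -> t <= T ->
  (forall x, s <= x <= t -> ystar < Psi x) -> Y s <= Y t.
Proof.
move=> s0 st tT yP.
have dY' (x : R) : s <= x <= t -> is_derive x 1 Y (f x).
  by move=> /andP[sx xt]; apply: dY; rewrite (le_trans s0 sx) (le_trans xt).
have [||x xst YE] := @MVT_segment _ Y f s t st.
- by move=> x; rewrite in_itv/= => /andP[? ?]; apply: dY'; rewrite !ltW.
- apply/subspace_continuousP => x; rewrite /= in_itv/= => xst.
  apply: cvg_within_filter.
  exact: (differentiable_continuous (is_derive1_differentiable (dY' x xst))).
move: xst; rewrite in_itv/= => xst.
rewrite -subr_ge0 YE; apply: mulr_ge0; last by rewrite subr_ge0.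
rewrite /f /P clampE; first exact/ltW/F_gt0/yP.
by case/andP: xst => sx xt; rewrite (le_trans s0 sx) (le_trans xt).
Qed.

Let Psi_step (s t : R) : 0 <= s -> s <= t -> t <= T ->
  (forall x, s <= x <= t -> ystar < Psi x) -> Psi s <= Psi t.
Proof.
move=> s0; rewrite le_eqVlt => /predU1P[->//|st] tT yP.
have := PsiY s0 st tT; have := Y_le s0 (ltW st) tT yP; lra.
Qed.

(** Growth is known only while Psi > [ystar], which is itself a consequence of growth; continuity
    breaks the circle. At the supremum of the times up to [t] where Psi >= Psi 0, this inequality
    persists, so Psi stays above [ystar] a little longer and [Psi_step] carries the inequality past
    the supremum. *)
Lemma blowup_ge0 t : 0 <= t <= T -> Psi 0 <= Psi t.
Proof.
move=> /andP[t0 tT]; rewrite leNgt; apply/negP => Pt.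
pose S := [set s | [/\ 0 <= s, s <= t & Psi 0 <= Psi s]].
have S0 : S 0 by split.
have hS : has_sup S by split; [exists 0|exists t => s []].
have supS0 : 0 <= sup S by apply: ub_le_sup => //; case: hS.
have supSt : sup S <= t by apply: ge_sup; [exists 0|move=> s []].
have supT : 0 <= sup S <= T by rewrite supS0 (le_trans supSt).
have near_sup y : Psi (sup S) < y \/ y < Psi (sup S) -> exists2 d, 0 < d &
    forall x, 0 <= x <= T -> `|sup S - x| < d ->
      (Psi (sup S) < y -> Psi x < y) /\ (y < Psi (sup S) -> y < Psi x).
  move=> yP; have e0 : 0 < `|Psi (sup S) - y|.
    by rewrite normr_gt0 subr_eq0 neq_lt; apply/orP.
  have [d /= d0 dP] : \forall x \near sup S, `|P (sup S) - P x| < `|Psi (sup S) - y|.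
    by move/cvgrPdist_lt : (@cP (sup S)); exact.
  exists d => // x xT /dP; rewrite /P !clampE// ltr_norml => /andP[h1 h2].
  split=> h; move: h1 h2; first by rewrite ltr0_norm; lra.
  by rewrite gtr0_norm; lra.
have Psup : Psi 0 <= Psi (sup S).
  rewrite leNgt; apply/negP => h.
  have [d d0 dP] := near_sup _ (or_introl h).
  have [s [s0 st Ps] sd] := sup_adherent d0 hS.
  have ss : s <= sup S by apply: ub_le_sup => //; case: hS.
  have sT : 0 <= s <= T by rewrite s0 (le_trans st).
  have [|/(_ h)] := dP s sT; first by rewrite ger0_norm ?subr_ge0//; lra.
  by rewrite ltNge Ps.
have supSt' : sup S < t.
  by rewrite lt_neqAle supSt andbT; apply: contra_ltN Pt => /eqP <-.
have ysup : ystar < Psi (sup S) by exact: lt_le_trans Psup.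
have [d d0 dP] := near_sup _ (or_intror ysup).
pose s1 := Num.min (sup S + d / 2) t.
have s1S : sup S < s1 by rewrite lt_min supSt' andbT ltrDl divr_gt0.
have s1t : s1 <= t by rewrite ge_min lexx orbT.
have s1d : s1 <= sup S + d / 2 by rewrite ge_min lexx.
have s1T : s1 <= T by exact: le_trans tT.
have s1P : Psi (sup S) <= Psi s1.
  apply: Psi_step => //; first exact: ltW.
  move=> x /andP[Sx xs].
  have xT : 0 <= x <= T by rewrite (le_trans supS0 Sx) (le_trans xs).
  by have [|_ ->//] := dP x xT; rewrite ler0_norm ?subr_le0//; lra.
have : S s1 by split; [exact: le_trans (ltW s1S)|by []|exact: le_trans s1P].
by move=> /(ub_le_sup hS.2); rewrite leNgt s1S.
Qed.

Let Psi_gt t : 0 <= t <= T -> ystar < Psi t.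
Proof. by move=> /blowup_ge0; exact: lt_le_trans. Qed.

Lemma blowup_nondecreasing s t : 0 <= s -> s <= t -> t <= T -> Psi s <= Psi t.
Proof.
move=> s0 st tT; apply: Psi_step => // x /andP[sx xt]; apply: Psi_gt.
by rewrite (le_trans s0 sx) (le_trans xt).
Qed.

(** The minorant [Z] of [Psi] is differentiable, and Z' = F(Psi) >= F(Z) because F is nondecreasing
    beyond [ystar]. Hence H(Z t) + t is nonincreasing, and H >= 0 at the final time gives the
    bound. *)
Lemma blowup_time : T <= H (Psi 0).
Proof.
pose Z t := Psi 0 - Y 0 + Y t.
have ZP t : 0 <= t <= T -> Psi 0 <= Z t <= Psi t.
  move=> /andP[t0 tT].
  have h1 : Y 0 <= Y t.
    apply: Y_le => // x /andP[x0 xt]; apply: Psi_gt.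
    by rewrite x0 (le_trans xt).
  have h2 : Psi 0 - Y 0 <= Psi t - Y t.
    by move: t0; rewrite le_eqVlt => /predU1P[<-//|t0]; exact: PsiY.
  by rewrite /Z; apply/andP; split; lra.
have dZ (t : R) : 0 <= t <= T -> is_derive t 1 Z (f t).
  by move=> tT; have := is_deriveD (is_derive_cst (Psi 0 - Y 0) t 1) (dY tT); rewrite add0r.
have Zy t : 0 <= t <= T -> ystar < Z t.
  by move=> /ZP /andP[+ _]; exact: lt_le_trans.
pose G t := H (Z t) + t.
have dG (t : R) : 0 <= t <= T -> is_derive t 1 G (- (F (Z t))^-1 * f t + 1).
  move=> tT; have := is_derive1_comp (is_derive_H (Zy t tT)) (dZ t tT).
  by move=> d; exact: (is_deriveD d (is_derive_id t 1)).
have [||x xT GE] := @MVT_segment _ G (fun t => - (F (Z t))^-1 * f t + 1) 0 T (ltW T0).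
- by move=> x; rewrite in_itv/= => /andP[? ?]; apply: dG; rewrite !ltW.
- apply/subspace_continuousP => x; rewrite /= in_itv/= => xT.
  apply: cvg_within_filter.
  exact: (differentiable_continuous (is_derive1_differentiable (dG x xT))).
move: xT; rewrite in_itv/= => xT.
have GT : G T <= G 0.
  rewrite -subr_le0 GE subr0 mulr_le0_ge0 ?(ltW T0)//.
  rewrite mulNr addrC subr_le0 -ler_pdivrMl ?invr_gt0 ?F_gt0 ?Zy// invrK mulr1.
  rewrite /f /P clampE//; apply: F_le; first exact: Zy.
  by have /andP[] := ZP x xT.
have HT : 0 <= H (Z T) by apply/H_ge0/Zy; rewrite lexx ltW.
have Z0 : Z 0 = Psi 0 by rewrite /Z subrK.
have {}GT : H (Z T) + T <= H (Psi 0) by rewrite -Z0 -[leRHS]addr0; exact: GT.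
by apply: le_trans GT; rewrite lerDr.
Qed.

End blowup_inequality.

(** * Fubini's theorem and slices on a product of sets *)

Section fubini_rectangle.
Context {R : realType} d1 d2 (T1 : measurableType d1) (T2 : measurableType d2).
Variables (m1 : {sigma_finite_measure set T1 -> \bar R}) (m2 : {sigma_finite_measure set T2 -> \bar R}).
Variables (D1 : set T1) (D2 : set T2).
Hypotheses (mD1 : measurable D1) (mD2 : measurable D2).

Lemma integrable_fine d (T : measurableType d) (mu : {measure set T -> \bar R}) (D : set T)
    (F : T -> \bar R) : measurable D -> mu.-integrable D F ->
  mu.-integrable D (EFin \o (fine \o F)) /\
  \int[mu]_(x in D) (fine (F x)) = fine (\int[mu]_(x in D) F x).
Proof.
move=> mD iF; have mF := measurable_int mu iF.
have mfF : measurable_fun D (EFin \o (fine \o F)).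
  by apply/measurable_EFinP; apply: (measurable_comp (F := setT)) mF => //; exact: fine_measurable.
split.
  by apply: le_integrable iF => // x _ /=; case: (F x) => [r| |]//=; rewrite ?normr0 ?leey.
congr fine; apply: ae_eq_integral => //.
have := integrable_ae mD iF; apply: filterS => x Fx Dx.
by rewrite /= fineK// Fx.
Qed.

Lemma patch_rectangle (f : T1 -> T2 -> R) x y :
  ((fun p => (f p.1 p.2)%:E) \_ (D1 `*` D2)) (x, y) =
  if x \in D1 then (if y \in D2 then (f x y)%:E else 0%E) else 0%E.
Proof. by rewrite /patch in_setX/=; case: (x \in D1); case: (y \in D2). Qed.

(** The function is extended by 0 to the whole product space, where Fubini's theorem is applied, and
    the conclusions are restricted again. *)
Lemma fubini_rectangle (f : T1 -> T2 -> R) :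
  (m1 \x m2)%E.-integrable (D1 `*` D2) (fun p => (f p.1 p.2)%:E) ->
  [/\ m1.-integrable D1 (EFin \o (fun x => \int[m2]_(y in D2) f x y)),
      m2.-integrable D2 (EFin \o (fun y => \int[m1]_(x in D1) f x y)),
      {ae m1, forall x, D1 x -> m2.-integrable D2 (EFin \o f x)},
      {ae m2, forall y, D2 y -> m1.-integrable D1 (EFin \o f ^~ y)} &
      \int[m1]_(x in D1) \int[m2]_(y in D2) f x y =
      \int[m2]_(y in D2) \int[m1]_(x in D1) f x y].
Proof.
move=> fi; set G := (fun p => (f p.1 p.2)%:E) \_ (D1 `*` D2).
have mDD : measurable (D1 `*` D2) by exact: measurableX.
have iG : (m1 \x m2)%E.-integrable setT G by apply/(integrable_mkcond _ mDD).
have F1 : {in D1, fubini_F m2 G =1 fun x => (\int[m2]_(y in D2) (f x y)%:E)%E}.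
  move=> x xD; rewrite /fubini_F [RHS]integral_mkcond; apply: eq_integral => y _.
  by rewrite /G patch_rectangle xD.
have F2 : {in D2, fubini_G m1 G =1 fun y => (\int[m1]_(x in D1) (f x y)%:E)%E}.
  move=> y yD; rewrite /fubini_G [RHS]integral_mkcond; apply: eq_integral => x _.
  by rewrite /G patch_rectangle yD.
have i1 : m1.-integrable D1 (fun x => (\int[m2]_(y in D2) (f x y)%:E)%E).
  apply: eq_integrable F1 _ => //; apply: integrableS (integrable_fubini_F iG) => //.
have i2 : m2.-integrable D2 (fun y => (\int[m1]_(x in D1) (f x y)%:E)%E).
  apply: eq_integrable F2 _ => //; apply: (integrableS (E := setT)) => //.
  have mG := measurable_int _ iG.
  apply/integrableP; split; first exact: (measurable_fubini_G iG).
  apply: le_lt_trans ((integrable21ltyP m1 m2 mG).1 iG); apply: ge0_le_integral => //.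
  - by apply: measurableT_comp => //; exact: (measurable_fubini_G iG).
  - apply: (measurable_fun_fubini_tonelli_G (abse \o G)) => [|y]; last exact: abse_ge0.
    exact: measurableT_comp.
  - move=> y _; apply: le_abse_integral => //.
    exact: (measurableT_comp mG (pair2_measurable y)).
have [j1 e1] := integrable_fine mD1 i1.
have [j2 e2] := integrable_fine mD2 i2.
split => //.
- have := ae_integrable1 iG; apply: filterS => x ix Dx.
  apply/(integrable_mkcond _ mD2); apply: eq_integrable ix => // y _.
  by rewrite /G patch_rectangle mem_set.
- have := ae_integrable2 iG; apply: filterS => y iy Dy.
  apply/(integrable_mkcond _ mD1); apply: eq_integrable iy => // x _.
  by rewrite /G patch_rectangle (mem_set Dy).
- rewrite e1 e2; congr fine.
  transitivity (\int[m1]_x (fubini_F m2 G x))%E.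
    rewrite integral_mkcond; apply: eq_integral => x _; rewrite /patch.
    case: ifPn => [xD|xD]; first by rewrite F1.
    by rewrite /fubini_F integral0_eq// => y _; rewrite /G patch_rectangle (negbTE xD).
  rewrite integral12_prod_meas1// -integral21_prod_meas1//.
  rewrite [RHS]integral_mkcond; apply: eq_integral => y _; rewrite /patch.
  case: ifPn => [yD|yD]; first by rewrite F2.
  rewrite /fubini_G integral0_eq// => x _; rewrite /G patch_rectangle (negbTE yD).
  by case: ifP.
Qed.

(** The measures of the sections of a null set integrate to 0, so almost all of them vanish. *)
Lemma ae_xsection (Q : T1 * T2 -> Prop) : {ae (m1 \x m2)%E, forall p, Q p} ->
  {ae m1, forall x, {ae m2, forall y, Q (x, y)}}.
Proof.
case=> A [mA A0 QA].
have m0 : (\int[m1]_x `|(m2 \o xsection A) x| = 0)%E.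
  by rewrite -[RHS]A0; apply: eq_integral => x _; rewrite gee0_abs.
have := (ae_eq_integral_abs m1 measurableT (measurable_fun_xsection m2 mA)).1 m0.
apply: filterS => x /(_ I) Ax.
exists (xsection A x); split => //; first exact: measurable_xsection.
by move=> y /= nQ; rewrite /xsection/= inE; exact: QA.
Qed.

Lemma square_integrable_slice (w : T1 -> T2 -> R) :
  square_integrable (m1 \x m2)%E (D1 `*` D2) (fun p => w p.1 p.2) ->
  {ae m1, forall x, D1 x -> square_integrable m2 D2 (w x)}.
Proof.
move=> [mw iw].
have mDD : measurable (D1 `*` D2) by exact: measurableX.
have [_ _ + _ _] := @fubini_rectangle (fun x y => w x y ^+ 2) iw.
apply: filterS => x ix Dx; split; last exact: ix.
have mW : measurable_fun setT ((fun p => w p.1 p.2) \_ (D1 `*` D2)).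
  exact: (measurable_restrictT _ mDD).1 mw.
have := measurable_funTS (D := D2) (measurableT_comp mW (pair1_measurable x)).
apply: eq_measurable_fun => y; rewrite inE => Dy.
by rewrite /= /patch mem_set.
Qed.

Lemma square_integrable_prod (f : T1 -> R) (g : T2 -> R) (M : R) : (m1 D1 < +oo)%E ->
  measurable_fun D1 f -> (forall x, D1 x -> `|f x| <= M) -> square_integrable m2 D2 g ->
  square_integrable (m1 \x m2)%E (D1 `*` D2) (fun p => g p.2 * f p.1).
Proof.
move=> finD1 mf fM [mg ig].
have mDD : measurable (D1 `*` D2) by exact: measurableX.
have mF : measurable_fun (D1 `*` D2) (fun p : T1 * T2 => f p.1).
  have := measurable_funTS (D := D1 `*` D2)
    (measurableT_comp ((measurable_restrictT _ mD1).1 mf) (@measurable_fst _ _ T1 T2)).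
  by apply: eq_measurable_fun => p; rewrite inE => -[Dp _]; rewrite /= /patch mem_set.
have mG : measurable_fun (D1 `*` D2) (fun p : T1 * T2 => g p.2).
  have := measurable_funTS (D := D1 `*` D2)
    (measurableT_comp ((measurable_restrictT _ mD2).1 mg) (@measurable_snd _ _ T1 T2)).
  by apply: eq_measurable_fun => p; rewrite inE => -[_ Dp]; rewrite /= /patch mem_set.
have mFG : measurable_fun (D1 `*` D2) (fun p : T1 * T2 => g p.2 * f p.1) by exact: measurable_funM.
split => //.
have mg2 : measurable_fun (D1 `*` D2) (fun p : T1 * T2 => (g p.2 ^+ 2)%:E).
  by apply/measurable_EFinP; exact: measurable_funX.
have ig2 : (m1 \x m2)%E.-integrable (D1 `*` D2) (fun p : T1 * T2 => (g p.2 ^+ 2)%:E).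
  apply/(integrable_mkcond _ mDD); apply/integrable12ltyP.
    exact: (measurable_restrictT _ mDD).1 mg2.
  pose C := (\int[m2]_(y in D2) (g y ^+ 2)%:E)%E.
  have -> : (\int[m1]_x \int[m2]_y
      `|((fun p : T1 * T2 => (g p.2 ^+ 2)%:E) \_ (D1 `*` D2)) (x, y)| = \int[m1]_(x in D1) C)%E.
    rewrite [RHS]integral_mkcond; apply: eq_integral => x _.
    rewrite [RHS]/patch; case: ifPn => xD.
      rewrite /C [RHS]integral_mkcond; apply: eq_integral => y _.
      rewrite (patch_rectangle (fun _ y => g y ^+ 2)) xD /patch.
      by case: ifP => _; rewrite ?abse0// gee0_abs// lee_fin sqr_ge0.
    rewrite integral0_eq// => y _.
    by rewrite (patch_rectangle (fun _ y => g y ^+ 2)) (negbTE xD) abse0.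
  have Cfin : C \is a fin_num by exact: integrable_fin_num.
  have C0 : (0 <= C)%E by apply: integral_ge0 => y _; rewrite lee_fin sqr_ge0.
  rewrite integral_cst//; apply: lte_mul_pinfty => //.
apply: le_integrable (integrableZl mDD (M ^+ 2) ig2) => //.
  by apply/measurable_EFinP; exact: measurable_funX.
move=> p [Dp1 Dp2] /=; rewrite lee_fin (ger0_norm (sqr_ge0 _)).
rewrite ger0_norm; last by apply: mulr_ge0; exact: sqr_ge0.
rewrite exprMn mulrC ler_wpM2r ?sqr_ge0//.
rewrite -(real_normK (num_real (f p.1))) lerXn2r ?nnegrE ?normr_ge0 ?fM//.
by apply: le_trans (fM _ Dp1); exact: normr_ge0.

Qed.

End fubini_rectangle.

(** * Moments in space as functions of time *)

Section moments.
Context {R : realType} {N : nat} (Omega : set 'rV[R]_N).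
Hypothesis mO : measurable Omega.
Hypothesis finO : (lebesgue_rV N Omega < +oo)%E.
Local Notation mu := (lebesgue_rV N).
Local Notation leb := (@lebesgue_measure R).
Local Notation L2 := (square_integrable mu Omega).

Lemma ae_integrable d (T : measurableType d) (m : {measure set T -> \bar R}) (D : set T)
    (f g : T -> R) : measurable D -> measurable_fun D f -> m.-integrable D (EFin \o g) ->
  {ae m, forall x, D x -> f x = g x} -> m.-integrable D (EFin \o f).
Proof.
move=> mD mf gi fg; have /integrableP[mg goo] := gi.
apply/integrableP; split; first exact/measurable_EFinP.
rewrite (@ae_eq_integral _ _ _ m D (fun x => `|(EFin \o g) x|)%E (fun x => `|(EFin \o f) x|)%E) //.
- by apply: measurableT_comp => //; exact/measurable_EFinP.
- exact: measurableT_comp.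
- by apply: filterS fg => x fg Dx; rewrite /= fg.
Qed.

Lemma L2_L2_moment (T : R) (w : R -> 'rV[R]_N -> R) (phi : 'rV[R]_N -> R) (eta : R -> R) (M : R) :
  L2_L2 T Omega w -> L2 phi -> continuous eta -> (forall t, `|eta t| <= M) ->
  [/\ leb.-integrable `]0, T[ (EFin \o (fun t => (\int[mu]_(x in Omega) (w t x * phi x)) * eta t)),
      mu.-integrable Omega (EFin \o (fun x => phi x * \int[leb]_(t in `]0, T[) (w t x * eta t))) &
      \int[leb]_(t in `]0, T[) ((\int[mu]_(x in Omega) (w t x * phi x)) * eta t) =
      \int[mu]_(x in Omega) (phi x * \int[leb]_(t in `]0, T[) (w t x * eta t))].
Proof.
move=> Lw Lphi ceta etaM.
pose I := `]0, T[%classic : set (measurableTypeR R).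
have mI : measurable I by exact: measurable_itv.
have finI : (leb I < +oo)%E.
  by rewrite /I lebesgue_measure_itv/=; case: ifP => _; rewrite ?ltry// -EFinB ltry.
have mII := measurableX mI mO.
have meta : measurable_fun I eta by apply: measurable_funTS; exact: continuous_measurable_fun.
have int psi e : L2 psi -> continuous e -> (exists K, forall t, `|e t| <= K) ->
    (leb \x mu)%E.-integrable (I `*` Omega) (fun p => (w p.1 p.2 * (psi p.2 * e p.1))%:E).
  move=> Lpsi ce [K eK]; apply: (square_integrable_mul mII Lw).
  apply: (square_integrable_prod mI mO finI _ (fun t _ => eK t)) => //.
  by apply: measurable_funTS; exact: continuous_measurable_fun.
have L1 := square_integrable_cst mO 1 finO.
have cc : continuous (fun _ : R => 1 : R) by move=> t; exact: cvg_cst.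
have c1 : exists K : R, forall t : R, `|1 : R| <= K by exists 1 => t; rewrite normr1.
have fub psi e (ipsi : _) := @fubini_rectangle _ _ _ _ _ leb mu I Omega mI mO
  (fun t x => w t x * (psi x * e t)) ipsi.
(* Fubini is used with three weights: [phi * 1] and [1 * eta] make the two inner integrals
   measurable, and [phi * eta] gives the exchange. Constants leave an inner integral only where the
   slice is integrable, hence the almost everywhere equalities. *)
have [iwphi _ _ _ _] := fub _ _ (int _ _ Lphi cc c1).
have eE : exists K, forall t, `|eta t| <= K by exists M.
have [_ iweta _ aeweta _] := fub _ _ (int _ _ L1 ceta eE).
have [i1 i2 ae1 ae2 eq] := fub _ _ (int _ _ Lphi ceta eE).
have mweta : measurable_fun Omega (fun x => \int[leb]_(t in I) (w t x * eta t)).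
  have /integrableP[/measurable_EFinP + _] := iweta.
  apply: eq_measurable_fun => x _; apply: eq_Rintegral => t _.
  by rewrite mul1r.
have mU : measurable_fun I (fun t => (\int[mu]_(x in Omega) (w t x * phi x)) * eta t).
  apply: measurable_funM => //.
  have /integrableP[/measurable_EFinP + _] := iwphi.
  apply: eq_measurable_fun => t _; apply: eq_Rintegral => x _.
  by rewrite mulr1.
have aeU : {ae leb, forall t, I t -> (\int[mu]_(x in Omega) (w t x * phi x)) * eta t =
    \int[mu]_(x in Omega) (w t x * (phi x * eta t))}.
  apply: filterS (square_integrable_slice mI mO Lw) => t Lwt It.
  rewrite -RintegralZr//; last exact: (square_integrable_mul mO (Lwt It) Lphi).
  by apply: eq_Rintegral => x _; rewrite mulrA.
have /integrableP[/measurable_EFinP mi1 _] := i1.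
have /integrableP[/measurable_EFinP mi2 _] := i2.
have mphi : measurable_fun Omega (fun x => phi x * \int[leb]_(t in I) (w t x * eta t)).
  by apply: measurable_funM => //; case: Lphi.
have aephi : {ae mu, forall x, Omega x -> phi x * \int[leb]_(t in I) (w t x * eta t) =
    \int[leb]_(t in I) (w t x * (phi x * eta t))}.
  apply: filterS aeweta => x ix Ox; rewrite -RintegralZl//.
    by apply: eq_Rintegral => t _; ring.
  by apply: eq_integrable (ix Ox) => // t _; rewrite /= mul1r.
split; [exact: (ae_integrable mI mU i1 aeU)|exact: (ae_integrable mO mphi i2 aephi)|].
by rewrite (ae_eq_Rintegral mI mU mi1 aeU) eq; apply/esym/ae_eq_Rintegral.
Qed.

(** [W12_L2] gives a weak time derivative at almost every fixed point x; exchanging the integrals on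
    both sides transfers it to the moment. *)
Lemma W12_moment (T : R) (u ut : R -> 'rV[R]_N -> R) (phi : 'rV[R]_N -> R) (th : R -> R) :
  W12_L2 T Omega u ut -> L2 phi -> test_function `]0, T[%classic th ->
  [/\ leb.-integrable `]0, T[ (EFin \o (fun t => (\int[mu]_(x in Omega) (u t x * phi x)) * derive1 th t)),
      leb.-integrable `]0, T[ (EFin \o (fun t => (\int[mu]_(x in Omega) (ut t x * phi x)) * th t)) &
      \int[leb]_(t in `]0, T[) ((\int[mu]_(x in Omega) (u t x * phi x)) * derive1 th t) =
      - \int[leb]_(t in `]0, T[) ((\int[mu]_(x in Omega) (ut t x * phi x)) * th t)].
Proof.
move=> [Lu Lut uut] Lphi tth.
have [M thM] := test_function_bounded tth.
have tth' : test_function `]0, T[%classic (derive1 th).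
  have -> : derive1 th = iter_derive [:: 1 : R] th by apply/funext => y; rewrite derive1E.
  exact: test_function_iter_derive.
have [M' thM'] := test_function_bounded tth'.
have [i1 m1 e1] := L2_L2_moment Lu Lphi (test_function_continuous tth') thM'.
have [i2 m2 e2] := L2_L2_moment Lut Lphi (test_function_continuous tth) thM.
split => //; rewrite e1 e2 -mulN1r -RintegralZl//.
apply: ae_eq_Rintegral => //.
- by apply/measurable_EFinP; exact: measurable_int m1.
- by apply: measurable_funM => //; apply/measurable_EFinP; exact: measurable_int m2.
- by apply: filterS (uut _ tth) => x h Ox; rewrite h// mulN1r mulrN.
Qed.

End moments.

(** * Jensen's inequality and the equation satisfied by the moments *)

Section moment_inequality.
Context {R : realType}.

(** Young's inequality for z = y/m and 1, with exponents p and p/(p-1), reads z^p >= 1 + p(z - 1);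
    homogeneity moves the point of tangency from 1 to m. *)
Lemma powR_tangent (p m y : R) : 1 < p -> 0 < m -> 0 <= y ->
  m `^ p + p * m `^ (p - 1) * (y - m) <= y `^ p.
Proof.
move=> p1 m0 y0; have p0 : 0 < p := lt_trans ltr01 p1.
have q0 : 0 < p - 1 by rewrite subr_gt0.
have z0 : 0 <= y / m by rewrite divr_ge0// ltW.
have pq : p^-1 + (p / (p - 1))^-1 = 1 by field; rewrite !gt_eqF.
have := conjugate_powR z0 ler01 p0 (divr_gt0 p0 q0) pq.
rewrite powR1 mulr1 => h.
have h2 : p * (y / m) - (p - 1) <= (y / m) `^ p.
  have -> : (y / m) `^ p = p * ((y / m) `^ p / p) by field; rewrite gt_eqF.
  have -> : p * (y / m) - (p - 1) = p * (y / m - 1 / (p / (p - 1))).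
    by field; rewrite !gt_eqF.
  by rewrite ler_pM2l// lerBlDr.
have -> : y `^ p = m `^ p * (y / m) `^ p.
  by rewrite -powRM ?(ltW m0)// mulrC divfK// gt_eqF.
have mp0 : 0 < m `^ p by exact: powR_gt0.
rewrite -(ler_pM2l mp0) in h2; apply: le_trans h2.
rewrite -(@mulr_powRB1 _ m p) ?(ltW m0)// le_eqVlt; apply/orP; left; apply/eqP.
by field; rewrite gt_eqF.
Qed.

Context {N : nat} (Omega : set 'rV[R]_N).
Hypothesis mO : measurable Omega.
Hypothesis finO : (lebesgue_rV N Omega < +oo)%E.
Local Notation mu := (lebesgue_rV N).
Local Notation leb := (@lebesgue_measure R).
Local Notation L2 := (square_integrable mu Omega).

Variables (phi : 'rV[R]_N -> R) (p : R).
Hypothesis p1 : 1 < p.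
Hypothesis Lphi : L2 phi.
Hypothesis phi0 : ae_nonneg Omega phi.
Hypothesis phi1 : \int[mu]_(x in Omega) (phi x ^+ 2) = 1.

Let A := \int[mu]_(x in Omega) phi x.

Let A0 : 0 < A.
Proof. by apply: Rintegral_gt0_sqr => //; rewrite phi1 oner_neq0. Qed.

Let A_le : A ^+ 2 <= fine (mu Omega).
Proof.
have := Rintegral_cauchy_schwarz mO Lphi (square_integrable_cst mO 1 finO).
rewrite phi1 mul1r; under eq_Rintegral do rewrite mulr1.
move/le_trans; apply; rewrite expr1n.
by rewrite Rintegral_cst// mul1r.
Qed.

(** [A_le] is Cauchy-Schwarz for phi and 1; raised to the negative power (1 - p)/2 it yields the
    volume factor of [c_bar]. *)
Let A_powR : fine (mu Omega) `^ (- ((p - 1) / 2)) <= A `^ (1 - p).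
Proof.
have q0 : 0 < (p - 1) / 2 by rewrite divr_gt0// subr_gt0.
have mO0 : 0 < fine (mu Omega) by apply: lt_le_trans A_le; rewrite exprn_gt0.
have -> : 1 - p = - (p - 1) by rewrite opprB.
rewrite !powRN lef_pV2 ?posrE ?powR_gt0//.
have -> : A `^ (p - 1) = (A ^+ 2) `^ ((p - 1) / 2).
  by rewrite -powR_mulrn ?(ltW A0)// -powRrM; congr (_ `^ _); field.
by apply: ge0_ler_powR; rewrite ?nnegrE ?(ltW mO0) ?(ltW q0) ?sqr_ge0 ?A_le.
Qed.

Lemma moment_ge0 w : L2 w -> ae_nonneg Omega w -> 0 <= \int[mu]_(x in Omega) (w x * phi x).
Proof.
move=> [mw _] w0; apply: ae_Rintegral_ge0 => //.
  by apply: measurable_funM => //; case: Lphi.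
by apply: filterS2 w0 phi0 => x w0 f0 Ox; rewrite mulr_ge0 ?w0 ?f0.
Qed.

(* Jensen's inequality in its tangent-line form, which does not require [w ^ p]
   to be integrable. *)
Lemma moment_tangent (m : R) w g : 0 < m -> L2 w -> L2 g -> ae_nonneg Omega w ->
  {ae mu, forall x, Omega x -> w x `^ p <= g x} ->
  m `^ p * A + p * m `^ (p - 1) * (\int[mu]_(x in Omega) (w x * phi x) - m * A) <=
  \int[mu]_(x in Omega) (g x * phi x).
Proof.
move=> m0 Lw Lg w0 wg.
have iphi : mu.-integrable Omega (EFin \o phi) by exact: square_integrable_integrable.
have iwphi := square_integrable_mul mO Lw Lphi.
pose b := p * m `^ (p - 1); pose a := m `^ p - b * m.
have i1 : mu.-integrable Omega (EFin \o (fun x => a * phi x)) by exact: (integrableZl mO a iphi).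
have i2 : mu.-integrable Omega (EFin \o (fun x => b * (w x * phi x))) by exact: (integrableZl mO b iwphi).
rewrite [leLHS](_ : _ = \int[mu]_(x in Omega) (a * phi x + b * (w x * phi x))); last first.
  by rewrite RintegralD// !RintegralZl// -/A /a /b; ring.
apply: ae_le_Rintegral => //.
- exact: (integrableD mO i1 i2).
- exact: (square_integrable_mul mO Lg Lphi).
apply: filterS3 w0 phi0 wg => x w0 f0 wg Ox.
have := powR_tangent p1 m0 (w0 Ox).
move=> h; have {}h := le_trans h (wg Ox).
have := ler_wpM2r (f0 Ox) h; apply: le_trans.
by rewrite le_eqVlt; apply/orP; left; apply/eqP; rewrite /a /b; ring.
Qed.

Lemma moment_superlinear (u v gu gv : 'rV[R]_N -> R) (k K1 K2 : R) :
  L2 u -> L2 v -> L2 gu -> L2 gv -> ae_nonneg Omega u -> ae_nonneg Omega v ->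
  {ae mu, forall x, Omega x -> v x `^ p <= gu x} ->
  {ae mu, forall x, Omega x -> u x `^ p <= gv x} ->
  0 <= k -> k <= K1 -> k <= K2 ->
  2 `^ (1 - p) * fine (mu Omega) `^ (- ((p - 1) / 2)) * k *
    (\int[mu]_(x in Omega) (u x * phi x) + \int[mu]_(x in Omega) (v x * phi x)) `^ p <=
  K1 * \int[mu]_(x in Omega) (gu x * phi x) + K2 * \int[mu]_(x in Omega) (gv x * phi x).
Proof.
move=> Lu Lv Lgu Lgv u0 v0 vgu ugv k0 kK1 kK2.
set U := \int[mu]_(x in Omega) (u x * phi x); set V := \int[mu]_(x in Omega) (v x * phi x).
set Gu := \int[mu]_(x in Omega) (gu x * phi x); set Gv := \int[mu]_(x in Omega) (gv x * phi x).
have U0 : 0 <= U by exact: moment_ge0.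
have V0 : 0 <= V by exact: moment_ge0.
have Gu0 : 0 <= Gu.
  apply: moment_ge0 => //; apply: filterS vgu => x h Ox.
  by apply: le_trans (h Ox); exact: powR_ge0.
have Gv0 : 0 <= Gv.
  apply: moment_ge0 => //; apply: filterS ugv => x h Ox.
  by apply: le_trans (h Ox); exact: powR_ge0.
apply: (@le_trans _ _ (k * (Gu + Gv))); last first.
  by rewrite mulrDr lerD// ler_wpM2r.
rewrite mulrAC [leRHS]mulrC ler_wpM2r//.
have p0 : 0 < p := lt_trans ltr01 p1.
have [UV0|UV0] := leP (U + V) 0.
  have -> : U + V = 0 by apply/eqP; rewrite eq_le UV0 addr_ge0.
  by rewrite powR0 ?gt_eqF// mulr0 addr_ge0.
(* The average of the two means U/A and V/A: with this common tangent point the first-order terms of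
   the two inequalities cancel, and 2 m^p A = 2^(1-p) A^(1-p) (U + V)^p remains. *)
pose m := (U + V) / (2 * A).
have m0 : 0 < m by rewrite divr_gt0// mulr_gt0.
have h1 := moment_tangent m0 Lv Lgu v0 vgu.
have h2 := moment_tangent m0 Lu Lgv u0 ugv.
apply: (@le_trans _ _ (2 * (m `^ p * A))); last first.
  rewrite -/U -/V -/Gu -/Gv in h1 h2.
  have : p * m `^ (p - 1) * (V - m * A) + p * m `^ (p - 1) * (U - m * A) = 0.
    rewrite -mulrDr (_ : V - m * A + (U - m * A) = 0) ?mulr0// /m.
    by field; rewrite gt_eqF.
  lra.
have -> : 2 * (m `^ p * A) = 2 `^ (1 - p) * A `^ (1 - p) * (U + V) `^ p.
  have A2 : 0 <= 2 * A by rewrite mulr_ge0// ltW.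
  have e2 : 2 `^ (1 - p) = 2 / 2 `^ p :> R.
    by rewrite powRB ?pnatr_eq0 ?implybT// powRr1.
  have eA : A `^ (1 - p) = A / A `^ p by rewrite powRB ?(gt_eqF A0) ?implybT// powRr1// ltW.
  have -> : m `^ p = (U + V) `^ p / (2 `^ p * A `^ p).
    rewrite /m powRM ?invr_ge0 ?(ltW UV0)//; congr (_ * _).
    by rewrite -powRM ?(ltW A0)// -[in LHS]powR_inv1// -powRrM mulN1r powRN.
  by rewrite e2 eA; field; rewrite !gt_eqF ?powR_gt0.
by rewrite ler_wpM2r ?powR_ge0// ler_wpM2l ?powR_ge0.
Qed.

(** At almost every time the equation holds for almost every x and can be integrated against [phi].
    The source enters through a measurable representative [g], since [h t] need not be
    measurable. *)
Lemma strong_solution_moment (T Lambda : R) (dl k : R -> R) (h u : R -> 'rV[R]_N -> R) :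
  eigenpair Omega Lambda phi -> strong_solution T Omega dl k h u ->
  exists2 ut, W12_L2 T Omega u ut & {ae leb, forall t : R, t \in `]0, T[ ->
    exists g, [/\ L2 g, {ae mu, forall x, Omega x -> h t x = g x} &
    \int[mu]_(x in Omega) (ut t x * phi x) =
    k t * \int[mu]_(x in Omega) (g x * phi x) - dl t * Lambda * \int[mu]_(x in Omega) (u t x * phi x)]}.
Proof.
move=> ephi [[su _] [g Lg hg] [D [ut [[LD jD] Wut eqn]]]]; exists ut => //.
pose I := `]0, T[%classic : set (measurableTypeR R).
have mI : measurable I by exact: measurable_itv.
have [_ Lut _] := Wut.
have ag := square_integrable_slice mI mO Lg.
have aut := square_integrable_slice mI mO Lut.
have ahg := ae_xsection hg.
have aeqn := ae_xsection eqn.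
(* The coefficients need not be measurable in [t], hence an argument at fixed [t]. *)
have ae1 := ae_lebesgueS2 (fun _ => @conj _ _) ag aut.
have ae2 := ae_lebesgueS2 (fun _ => @conj _ _) ahg aeqn.
apply: ae_lebesgueS2 jD (ae_lebesgueS2 (fun _ => @conj _ _) ae1 ae2).
move=> t jDt [[gt utt] [hgt eqt]] tI; exists (g t); split.
- exact: gt.
- by apply: filterS hgt => x hgx Ox; apply: hgx.
have tI' : t \in `[0, T] by apply: subset_itv_oo_cc tI.
have eig := Rintegral_bilaplacian_eigen mO finO ephi (su t tI') (jDt tI).
have LB := bilaplacian_L2 mO (jDt tI).
have i1 := square_integrable_mul mO (gt tI) Lphi.
have i2 := square_integrable_mul mO LB Lphi.
rewrite -mulrA -eig -!RintegralZl// -RintegralB//.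
- apply: ae_eq_Rintegral => //.
  + by apply: measurable_funM; [case: (utt tI)|case: Lphi].
  + apply: measurable_funB; apply: measurable_funM => //; apply/measurable_EFinP;
      (exact: measurable_int i1 || exact: measurable_int i2).
  + apply: filterS2 hgt eqt => x hgx eqx Ox.
    have := eqx (conj tI Ox); rewrite /= hgx//= => e.
    by rewrite !mulrA -mulrBl; congr (_ * _); rewrite -e; ring.
- exact: (integrableZl mO (k t) i1).
- exact: (integrableZl mO (dl t) i2).
Qed.

Lemma C_sobolev0_moment (T : R) (u : R -> 'rV[R]_N -> R) : C_sobolev0 2 T Omega u ->
  {in `[0, T], forall t0, \int[mu]_(x in Omega) (u t x * phi x)
    @[t --> within `[0, T]%classic (nbhs t0)] --> \int[mu]_(x in Omega) (u t0 x * phi x)}.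
Proof.
move=> [su [D jD cD]] t0 t0T.
apply: cvg_Rintegral_mul => //.
- near=> t; apply: (sobolev_jet_L2_nil (k := 2) (D := D t)); apply: jD.
  by near: t; exact: withinT.
- exact: (sobolev_jet_L2_nil (jD t0 t0T)).
have c0 := jet_sqnorm_cvg (s := [::]) (leq0n 2) (cD t0 t0T).
have FF : Filter (within `[0, T]%classic (nbhs t0)) by exact: within_filter.
apply: cvg_trans (c0 FF); apply: near_eq_cvg; near=> t.
have tT : t \in `[0, T] by near: t; exact: withinT.
by have [-> _] := jD t tT; have [-> _] := jD t0 t0T.
Unshelve. all: by end_near. Qed.

End moment_inequality.

(** * Bounds on the coefficients, finiteness of the life span, and the conclusion *)

Section explosion.
Context {R : realType}.

Lemma life_span_nonempty (tstar : \bar R) : (0 < tstar)%E -> exists t, life_span tstar t.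
Proof.
case: tstar => [s| |]//; last by exists 1; split => //; exact: ltry.
rewrite lte_fin => s0; exists (s / 2); split; first exact: divr_gt0.
by rewrite lte_fin; lra.
Qed.

Lemma le_delta_max (tstar : \bar R) (d1 d2 : R -> R) t :
  positive_bounded tstar d1 -> positive_bounded tstar d2 -> life_span tstar t ->
  d1 t <= delta_max tstar d1 d2 /\ d2 t <= delta_max tstar d1 d2.
Proof.
move=> [_ [M1 b1]] [_ [M2 b2]] lt; rewrite /delta_max !le_max; split.
  apply/orP; left; apply: ub_le_sup; last by exists t.
  by exists M1 => _ [s ls <-]; exact: b1.
apply/orP; right; apply: ub_le_sup; last by exists t.
by exists M2 => _ [s ls <-]; exact: b2.
Qed.

Lemma min_inf_le (tstar : \bar R) (k1 k2 : R -> R) t :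
  positive_bounded tstar k1 -> positive_bounded tstar k2 -> life_span tstar t ->
  Num.min (inf (k1 @` life_span tstar)) (inf (k2 @` life_span tstar)) <= k1 t /\
  Num.min (inf (k1 @` life_span tstar)) (inf (k2 @` life_span tstar)) <= k2 t.
Proof.
move=> [p1 _] [p2 _] lt; rewrite !ge_min; split.
  apply/orP; left; apply: ge_inf; last by exists t.
  by exists 0 => _ [s ls <-]; exact/ltW/p1.
apply/orP; right; apply: ge_inf; last by exists t.
by exists 0 => _ [s ls <-]; exact/ltW/p2.
Qed.

Lemma ball_rV_cube (N : nat) (c : 'rV[R]_N) (r : R) : 0 < r ->
  ball_rV c r `<=` rV_cube (r + \sum_(i < N) `|c 0 i|).
Proof.
move=> r0 x /(ball_rV_itv _ r0) xB i.
have ci : `|c 0 i| <= \sum_(j < N) `|c 0 j|.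
  by rewrite (bigD1 i)//= lerDl; apply: sumr_ge0.
rewrite /= in_itv/=; have /andP[h1 h2] := xB i; have := lexx `|c 0 i|.
by rewrite {1}ler_norml => /andP[h3 h4]; apply/andP; split; lra.
Qed.

Lemma nondecreasing_cvgy_at_left (F : R -> R) (T : R) : 0 < T ->
  (forall s t, 0 < s -> s <= t -> t < T -> F s <= F t) ->
  unbounded_at_left F T -> F t @[t --> T^'-] --> +oo.
Proof.
move=> T0 ndF uF; apply/cvgryPge => A.
have [s] := uF A T T0; rewrite subrr => /andP[s0 sT] As.
near=> t; apply: le_trans (ltW As) _; apply: ndF => //.
by near: t; exact: nbhs_left_ge.
Unshelve. all: by end_near. Qed.

Lemma le_of_lte_bound (tstar : \bar R) (B : R) : (0 < tstar)%E ->
  (forall T : R, 0 < T -> (T%:E < tstar)%E -> T <= B) ->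
  exists2 T : R, tstar = T%:E & T <= B.
Proof.
case: tstar => [s| |]// + bB; last first.
  have B1 : B < Num.max B 0 + 1 by rewrite ltr_pwDr// le_max lexx.
  have m0 : 0 < Num.max B 0 + 1 by rewrite ltr_pwDr// le_max lexx orbT.
  by have := bB _ m0 (ltry _); rewrite leNgt B1.
rewrite lte_fin => s0; exists s => //; rewrite leNgt; apply/negP => Bs.
have h : Num.max B 0 < s by rewrite gt_max Bs.
have h1 : B <= Num.max B 0 by rewrite le_max lexx.
have h2 : 0 <= Num.max B 0 by rewrite le_max lexx orbT.
have /(bB _ _) : (((Num.max B 0 + s) / 2)%:E < s%:E)%E by rewrite lte_fin; lra.
have -> : 0 < (Num.max B 0 + s) / 2 by lra.
by move=> /(_ isT); lra.
Qed.

End explosion.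

Theorem corollary1p1 (R : realType) (N : nat) (hN : (2 <= N)%N)
  (c : 'rV[R]_N) (r : R) (hr : 0 < r) (tstar : \bar R) (htstar : (0 < tstar)%E)
  (delta1 delta2 k1 k2 f1 f2 : R -> R) (p : R) (hp : 1 < p)
  (u0 v0 phi1 : 'rV[R]_N -> R) (u v : R -> 'rV[R]_N -> R) (Lambda1 : R) :
  let Omega := ball_rV c r in
  let delta := delta_max tstar delta1 delta2 in
  let cbar := c_bar p tstar Omega k1 k2 in
  let Psi0 := \int[lebesgue_rV N]_(x in Omega) (u0 x * phi1 x) +
              \int[lebesgue_rV N]_(x in Omega) (v0 x * phi1 x) in
  let Tbar := T_bar p delta Lambda1 cbar Psi0 in
  positive_bounded tstar delta1 -> positive_bounded tstar delta2 ->
  positive_bounded tstar k1 -> positive_bounded tstar k2 ->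
  (forall s, 0 <= s -> 0 <= f1 s) -> (forall s, 0 <= s -> 0 <= f2 s) ->
  sobolev0 2 Omega u0 -> sobolev0 2 Omega v0 ->
  ae_nonneg Omega u0 -> ae_nonneg Omega v0 ->
  nonneg_solution tstar Omega delta1 delta2 k1 k2 f1 f2 u0 v0 u v ->
  first_eigenpair Omega Lambda1 phi1 -> ae_nonneg Omega phi1 ->
  (forall s, 0 < s -> s `^ p <= f1 s) -> (forall s, 0 < s -> s `^ p <= f2 s) ->
  0 < cbar ->
  (delta * Lambda1 / cbar) `^ (1 / (p - 1)) < Psi0 ->
  exists T : R, [/\ tstar = T%:E, T <= Tbar &
    unbounded_at_left (Psi Omega phi1 u v) T ->
    Psi Omega phi1 u v t @[t --> T^'-] --> +oo].
Proof.
move=> Omega delta cbar Psi0 Tbar pd1 pd2 pk1 pk2 hf1 hf2 su0 sv0 _ _ [sol uv0 uu0 vv0].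
move=> [ephi _ phisq] phi0 f1p f2p cbar0 Psi0_gt.
have mO : measurable Omega := measurable_ball_rV c r.
have finO : (lebesgue_rV N Omega < +oo)%E := ball_rV_finite c hr.
have p0 : 0 < p := lt_trans ltr01 hp.
have Lphi : square_integrable (lebesgue_rV N) Omega phi1.
  by have [[D jD _] _ _] := ephi; exact: sobolev_jet_L2_nil jD.
have sL2 w : sobolev0 2 Omega w -> square_integrable (lebesgue_rV N) Omega w.
  by move=> [D jD _]; exact: sobolev_jet_L2_nil jD.
have Lambda0 : 0 < Lambda1.
  exact: (eigenvalue_gt0 mO (ball_rV_cube hr) (Ordinal (ltnW hN)) ephi phi0).
have [t0 lt0] := life_span_nonempty htstar.
have delta0 : 0 < delta.
  by apply: lt_le_trans (le_delta_max pd1 pd2 lt0).1; exact: pd1.1.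
have a0 : 0 < delta * Lambda1 by exact: mulr_gt0.
have k0 : 0 < Num.min (inf (k1 @` life_span tstar)) (inf (k2 @` life_span tstar)).
  rewrite ltNge; apply: contraTN cbar0 => km; rewrite -leNgt.
  by apply: mulr_ge0_le0 => //; rewrite mulr_ge0 ?powR_ge0.
set P := Psi Omega phi1 u v.
(* The growth condition concerns s > 0; where [w] vanishes, 0^p = 0 and the sign of [F] takes
   over. *)
have fp (w g : 'rV[R]_N -> R) (F : R -> R) : (forall s, 0 <= s -> 0 <= F s) ->
    (forall s, 0 < s -> s `^ p <= F s) -> ae_nonneg Omega w ->
    {ae lebesgue_rV N, forall x, Omega x -> F (w x) = g x} ->
    {ae lebesgue_rV N, forall x, Omega x -> w x `^ p <= g x}.
  move=> F0 Fp w0 Fg; apply: filterS2 w0 Fg => x w0 Fg Ox; rewrite -(Fg Ox).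
  have := w0 Ox; rewrite le_eqVlt => /predU1P[<-|]; last exact: Fp.
  by rewrite powR0 ?gt_eqF// F0.
have main (T : R) : 0 < T -> (T%:E < tstar)%E ->
    (forall s t, 0 <= s -> s <= t -> t <= T -> P s <= P t) /\ T <= Tbar.
  move=> T0 Tt; have [su sv] := sol T T0 Tt.
  have [Cu _ _] := su; have [Cv _ _] := sv.
  have zT : 0 \in `[0, T] by rewrite in_itv/= lexx ltW.
  have P0E : P 0 = Psi0.
    rewrite /P /Psi /Psi0; congr (_ + _); apply: ae_eq_Rintegral => //.
    - by apply: measurable_funM; [case: (sL2 _ (Cu.1 _ zT))|case: Lphi].
    - by apply: measurable_funM; [case: (sL2 _ su0)|case: Lphi].
    - by apply: filterS uu0 => x h Ox; rewrite h.
    - by apply: measurable_funM; [case: (sL2 _ (Cv.1 _ zT))|case: Lphi].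
    - by apply: measurable_funM; [case: (sL2 _ sv0)|case: Lphi].
    - by apply: filterS vv0 => x h Ox; rewrite h.
  have cP : {in `[0, T], forall t0, P t @[t --> within `[0, T]%classic (nbhs t0)] --> P t0}.
    move=> t tT; apply: cvgD.
      exact: (C_sobolev0_moment mO Lphi Cu).
    exact: (C_sobolev0_moment mO Lphi Cv).
  have P_ge0 t : 0 <= t <= T -> 0 <= P t.
    move=> /andP[]; rewrite le_eqVlt => /predU1P[<- _|tp tT].
      (* The sign of the solution is given for positive times; at time 0 the lower bound on [Psi0]
         supplies it. *)
      by rewrite P0E ltW// (le_lt_trans _ Psi0_gt)// powR_ge0.
    have tt : (t%:E < tstar)%E by apply: le_lt_trans Tt; rewrite lee_fin.
    have tT' : t \in `[0, T] by rewrite in_itv/= (ltW tp).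
    have [ut0 vt0] := uv0 t tp tt.
    by rewrite addr_ge0// moment_ge0//; apply: sL2; [exact: Cu.1|exact: Cv.1].
  have P0_gt : (delta * Lambda1 / cbar) `^ (1 / (p - 1)) < P 0 by rewrite P0E.
  have [ut Wu aeu] := strong_solution_moment mO finO Lphi ephi su.
  have [vt Wv aev] := strong_solution_moment mO finO Lphi ephi sv.
  (* The weak derivative of [P], taken from u_t and v_t: it is integrable against test functions,
     whereas the coefficients on the other side of the equation are not assumed measurable. *)
  pose b t := \int[lebesgue_rV N]_(x in Omega) (ut t x * phi1 x) +
              \int[lebesgue_rV N]_(x in Omega) (vt t x * phi1 x).
  have Pb : {ae @lebesgue_measure R, forall t, `]0, T[%classic t ->
      cbar * P t `^ p - delta * Lambda1 * P t <= b t}.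
    apply: ae_lebesgueS2 aeu aev => t aeu aev tI.
    have [gu [Lgu fgu utE]] := aeu tI; have [gv [Lgv fgv vtE]] := aev tI.
    move: tI; rewrite /= in_itv/= => /andP[tp tT].
    have tt : (t%:E < tstar)%E by apply: lt_trans Tt; rewrite lte_fin.
    have tT' : t \in `[0, T] by rewrite in_itv/= !ltW.
    have [ut0 vt0] := uv0 t tp tt.
    have [kk1 kk2] := min_inf_le pk1 pk2 (conj tp tt).
    have [dd1 dd2] := le_delta_max pd1 pd2 (conj tp tt).
    have Lu := sL2 _ (Cu.1 _ tT'); have Lv := sL2 _ (Cv.1 _ tT').
    have h : cbar * P t `^ p <= _ := moment_superlinear mO finO hp Lphi phi0 phisq Lu Lv Lgu Lgv ut0 vt0
      (fp _ _ _ hf1 f1p vt0 fgu) (fp _ _ _ hf2 f2p ut0 fgv) (ltW k0) kk1 kk2.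
    have U0 := moment_ge0 mO Lphi phi0 Lu ut0.
    have V0 := moment_ge0 mO Lphi phi0 Lv vt0.
    rewrite /b utE vtE.
    have h1 := ler_wpM2r U0 (ler_wpM2r (ltW Lambda0) dd1).
    have h2 := ler_wpM2r V0 (ler_wpM2r (ltW Lambda0) dd2).
    rewrite -/delta in h1 h2.
    have PE : delta * Lambda1 * P t = delta * Lambda1 * \int[lebesgue_rV N]_(x in Omega) (u t x * phi1 x) +
      delta * Lambda1 * \int[lebesgue_rV N]_(x in Omega) (v t x * phi1 x) by rewrite -mulrDr.
    by rewrite PE [leRHS]addrACA -opprD; apply: lerB => //; exact: lerD.
  have wP th : test_function `]0, T[%classic th ->
      (@lebesgue_measure R).-integrable `]0, T[ (EFin \o (fun t => b t * th t)) /\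
      \int[lebesgue_measure]_(t in `]0, T[) (P t * derive1 th t) =
      - \int[lebesgue_measure]_(t in `]0, T[) (b t * th t).
    move=> tth; have [i1 i2 e1] := W12_moment mO finO Wu Lphi tth.
    have [j1 j2 e2] := W12_moment mO finO Wv Lphi tth.
    have mI : measurable (`]0, T[%classic : set (measurableTypeR R)) by exact: measurable_itv.
    split.
      apply: eq_integrable (integrableD mI i2 j2) => // t _.
      by rewrite /b /= mulrDl.
    under eq_Rintegral do rewrite mulrDl; rewrite RintegralD// e1 e2 -opprD -RintegralD//.
    by congr (- _); apply: eq_Rintegral => t _; rewrite /b mulrDl.
  split.
    exact: (blowup_nondecreasing a0 cbar0 hp T0 cP P_ge0 P0_gt Pb wP).
  have := blowup_time a0 cbar0 hp T0 cP P_ge0 P0_gt Pb wP.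
  by rewrite P0E mulrA.
have [T tE TT] := le_of_lte_bound htstar (fun T T0 Tt => (main T T0 Tt).2).
exists T; split => // uP; move: htstar; rewrite tE lte_fin => T0.
apply: nondecreasing_cvgy_at_left uP => // s t s0 st tT.
have t0' := lt_le_trans s0 st.
have Tt : (t%:E < tstar)%E by rewrite tE lte_fin.
exact: ((main t t0' Tt).1 s t (ltW s0) st (lexx t)).
Qed.
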